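(* Consider the switched linear hyperbolic system described in the context (the numbers $m_i$ may depend on $i$). Assume that there exist $\nu>0$ and diagonal positive definite matrices $Q_i\in\mathbb{R}^{n\times n}$, $i\in I$, such that, for all $i\in I$, $$F_i^\top Q_i+Q_iF_i\le-2\nu Q_i,\qquad G_i^\top Q_i\Lambda_i^+G_i\le Q_i\Lambda_i^+,$$ and such that, for all $i,j\in I$, $$S_i^\top Q_iS_i=S_j^\top Q_jS_j.$$ Then the switched linear hyperbolic system is globally uniformly exponentially stable (GUES) with respect to the set $\mathcal{S}(\mathbb{R}_+,I)$ of all switching signals.
   Context: Notation: for symmetric matrices, $A\le B$ means $B-A$ is positive semidefinite; $I_p$, $0_{p,q}$ are identity and zero matrices; blocks of size zero are omitted. Switched system. $I$ is a finite set of modes. For each $i\in I$, $A_i,L_i\in\mathbb{R}^{n\times n}$, and there is an invertible $S_i\in\mathbb{R}^{n\times n}$ with $L_i=S_i^{-1}\Lambda_iS_i$, $\Lambda_i=\mathrm{diag}(\lambda_{i,1},\dots,\lambda_{i,n})$, $\lambda_{i,k}<0$ for $k\in\{1,\dots,m_i\}$ and $\lambda_{i,k}>0$ for $k\in\{m_i+1,\dots,n\}$. Set $F_i=S_iA_iS_i^{-1}$ and $\Lambda_i^+=\mathrm{diag}(|\lambda_{i,1}|,\dots,|\lambda_{i,n}|)$. Let $G_i=\begin{pmatrix} G_{i--} & G_{i-+} \\ G_{i+-} & G_{i++} \end{pmatrix}\in\mathbb{R}^{n\times n}$ with $G_{i--}\in\mathbb{R}^{m_i\times m_i}$ and the other blocks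 sized accordingly, and $B_i^0=\begin{pmatrix} -G_{i--} & 0_{m_i,n-m_i} \\ -G_{i+-} & I_{n-m_i} \end{pmatrix}S_i$, $B_i^1=\begin{pmatrix} I_{m_i} & -G_{i-+} \\ 0_{n-m_i,m_i} & -G_{i++} \end{pmatrix}S_i$. For a switching signal $\sigma$ the system is $$\partial_tw(t,x)+L_{\sigma(t)}\partial_xw(t,x)=A_{\sigma(t)}w(t,x),\quad B^0_{\sigma(t)}w(t,0)+B^1_{\sigma(t)}w(t,1)=0,\quad w(0,x)=w^0(x),$$ $x\in[0,1]$, $t\ge0$, with $w^0\in L^2((0,1);\mathbb{R}^n)$. Switching signals. A switching signal is a piecewise constant, right-continuous function $\sigma:\mathbb{R}_+\to I$ with finitely many discontinuities (switching times) on every bounded interval; $\mathcal{S}(\mathbb{R}_+,I)$ is the set of them. Solutions. Let $t_0=0$ and $t_1<t_2<\dots$ be the switching times. A (weak) solution is $w\in C^0(\mathbb{R}_+;L^2((0,1);\mathbb{R}^n))$ with $w(0,\cdot)=w^0$ such that on each interval $[t_k,t_{k+1}]$ (or $[t_k,\infty)$ if $t_k$ is the last switching time), with $i$ the value of $\sigma$ on $[t_k,t_{k+1})$, the function $y=S_iw=\begin{pmatrix} y^- \\ y^+ \end{pmatrix}$ ($y^-\in\mathbb{R}^{m_i}$) is a weak solution of $\partial_ty+\Lambda_i\partial_xy=F_iy$, $\begin{pmatrix} y^-(t,1) \\ y^+(t,0) \end{pmatrix}=G_i\begin{pmatrix} y^-(t,0) \\ y^+(t,1) \end{pmatrix}$;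 i.e. for every $T$ in the interval, $T>t_k$, and every $\varphi\in C^1([t_k,T]\times[0,1];\mathbb{R}^n)$ with $\Lambda_i^+\begin{pmatrix} \varphi^-(t,0) \\ \varphi^+(t,1) \end{pmatrix}=G_i^\top\Lambda_i^+\begin{pmatrix} \varphi^-(t,1) \\ \varphi^+(t,0) \end{pmatrix}$ for $t\in[t_k,T]$, one has $\int_0^1\varphi(T,x)^\top y(T,x)dx-\int_0^1\varphi(t_k,x)^\top y(t_k,x)dx=\int_{t_k}^T\int_0^1(\partial_t\varphi+\Lambda_i\partial_x\varphi+F_i^\top\varphi)^\top y\,dx\,dt$. For every $\sigma\in\mathcal{S}(\mathbb{R}_+,I)$ and $w^0$ a unique solution exists. GUES with respect to $\mathcal{S}\subseteq\mathcal{S}(\mathbb{R}_+,I)$: there exist $\nu>0$, $C>0$ such that for every $w^0\in L^2((0,1);\mathbb{R}^n)$ and every $\sigma\in\mathcal{S}$ the solution satisfies $\|w(t,\cdot)\|_{L^2((0,1);\mathbb{R}^n)}\le Ce^{-\nu t}\|w^0\|_{L^2((0,1);\mathbb{R}^n)}$ for all $t\ge0$. *)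

(* Defs.v *)
From HB Require Import structures.
From mathcomp Require Import all_boot all_order all_algebra.
From mathcomp Require Import all_classical all_reals all_analysis.

Set Implicit Arguments.
Unset Strict Implicit.
Unset Printing Implicit Defensive.

Import Order.TTheory GRing.Theory Num.Theory.
Import numFieldNormedType.Exports.

Local Open Scope classical_set_scope.
Local Open Scope ring_scope.

Section matrix_order.
Context {R : realType} {n : nat}.

Definition psdmx (M : 'M[R]_n) : Prop :=
  M^T = M /\ forall v : 'cV[R]_n, 0 <= (v^T *m M *m v) 0 0.

Definition posdefmx (M : 'M[R]_n) : Prop :=
  M^T = M /\ forall v : 'cV[R]_n, v != 0 -> 0 < (v^T *m M *m v) 0 0.

Definition lemx (A B : 'M[R]_n) : Prop := psdmx (B - A).

End matrix_order.

Section L2.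
Context {R : realType} {n : nat}.
Notation mu := (@lebesgue_measure R).

(** The inner product of [R^n] and the Euclidean norm (the library norm on
    matrices is the sup norm). *)
Definition dotv (u v : 'cV[R]_n) : R := (u^T *m v) 0 0.
Definition enorm (v : 'cV[R]_n) : R := Num.sqrt (dotv v v).

(** Elements of L^2((0,1); R^n) are given by representatives [R -> R^n], whose
    values outside (0,1) are irrelevant; equality in L^2 is equality almost
    everywhere on (0,1). *)
Definition L2 (u : R -> 'cV[R]_n) : Prop :=
  forall k, ((fun x : R => u x k 0) \_ `]0, 1[) \in Lfun mu 2%:E.

Definition L2norm (u : R -> 'cV[R]_n) : \bar R :=
  ('N[mu]_(2%:E)[(EFin \o (enorm \o u)) \_ `]0%R, 1%R[])%E.

(** [w] belongs to C^0([0,+oo); L^2((0,1); R^n)); [w t] is irrelevant for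
    negative [t]. *)
Definition C0L2 (w : R -> R -> 'cV[R]_n) : Prop :=
  (forall t : R, 0 <= t -> L2 (w t)) /\
  (forall t : R, 0 <= t ->
    L2norm (fun x => w s x - w t x)
      @[s --> within `[0, +oo[ (nbhs t)] --> 0%E).

(** [phi] is C^1 on the closed rectangle [a, b] x [0, 1] (a < b), with partial
    derivatives [dt] and [dx]: these exist in the open rectangle and extend
    continuously to the closed one. *)
Definition C1_rect (a b : R) (phi dt dx : R -> R -> 'cV[R]_n) : Prop :=
  [/\ forall k (f : R -> R -> 'cV[R]_n), f = phi \/ f = dt \/ f = dx ->
        {within `[a, b] `*` `[0, 1], continuous (fun p : R * R => f p.1 p.2 k 0)},
      forall k (t x : R), a < t < b -> 0 < x < 1 ->
        is_derive t 1 (fun s => phi s x k 0) (dt t x k 0)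
    & forall k (t x : R), a < t < b -> 0 < x < 1 ->
        is_derive x 1 (fun z => phi t z k 0) (dx t x k 0)].

End L2.

Section switching_signals.
Context {R : realType} {I : finType}.

(** Signals on [0,+oo) are functions [R -> I] of which only the values at
    nonnegative times matter. [I] is discrete, hence continuity at [t] means
    being constant near [t]. The initial time is not a switching time. *)
Definition switching_time (sigma : R -> I) (t : R) : Prop :=
  0 < t /\ ~ (\forall s \near t, sigma s = sigma t).

Definition switching_signal (sigma : R -> I) : Prop :=
  [/\ forall s t : R, 0 <= s -> s <= t ->
        (forall r : R, s < r <= t -> ~ switching_time sigma r) -> sigma s = sigma t,
      forall t : R, 0 <= t -> \forall s \near t^'+, sigma s = sigma t
    & forall T : R, finite_set [set t | switching_time sigma t /\ t <= T]].

End switching_signals.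

(** The modes [i : I], with [sysm i] negative and [n - sysm i] positive speeds
    [syslam i]. Components are numbered from 0, so the "-" components are those of
    index [k < sysm i]; the blocks of size [sysm i] and [n - sysm i] of a vector or
    matrix are expressed through this test on indices. *)
Record switched_system (R : realType) (n : nat) (I : finType) := SwitchedSystem {
  sysA : I -> 'M[R]_n;
  sysL : I -> 'M[R]_n;
  sysS : I -> 'M[R]_n;
  syslam : I -> 'rV[R]_n;
  sysm : I -> nat;
  sysG : I -> 'M[R]_n;
  sysm_le : forall i, (sysm i <= n)%N;
  sysS_unit : forall i, sysS i \in unitmx;
  sysLE : forall i, sysL i = invmx (sysS i) *m diag_mx (syslam i) *m sysS i;
  syslam_lt0 : forall i (k : 'I_n), (k < sysm i)%N -> syslam i 0 k < 0;
  syslam_gt0 : forall i (k : 'I_n), (sysm i <= k)%N -> 0 < syslam i 0 k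
}.

Section system.
Context {R : realType} {n : nat} {I : finType}.
Variable Sys : switched_system R n I.
Notation mu := (@lebesgue_measure R).

Definition Lam (i : I) : 'M[R]_n := diag_mx (syslam Sys i).
Definition Lamp (i : I) : 'M[R]_n := diag_mx (map_mx Num.norm (syslam Sys i)).
Definition sysF (i : I) : 'M[R]_n :=
  sysS Sys i *m sysA Sys i *m invmx (sysS Sys i).

(** The vector [(u^-; v^+)]. *)
Definition stack (i : I) (u v : 'cV[R]_n) : 'cV[R]_n :=
  \col_k (if (k < sysm Sys i)%N then u k 0 else v k 0).

(** The boundary matrices, and the equivalence between the boundary condition
    in [w] and the one in [y = S_i w] on which weak solutions are based. *)
Definition sysB0 (i : I) : 'M[R]_n :=
  (\matrix_(k, l) if (l < sysm Sys i)%N then - sysG Sys i k l else (k == l)%:R)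
    *m sysS Sys i.
Definition sysB1 (i : I) : 'M[R]_n :=
  (\matrix_(k, l) if (l < sysm Sys i)%N then (k == l)%:R else - sysG Sys i k l)
    *m sysS Sys i.

Lemma boundaryE (i : I) (w0 w1 : 'cV[R]_n) :
  let y0 := sysS Sys i *m w0 in let y1 := sysS Sys i *m w1 in
  sysB0 i *m w0 + sysB1 i *m w1 = 0 <->
  stack i y1 y0 = sysG Sys i *m stack i y0 y1.
Proof.
rewrite /= /sysB0 /sysB1 -!mulmxA.
move: (sysS Sys i *m w0) (sysS Sys i *m w1) => y0 y1.
set B := (X in X = 0).
have -> : B = stack i y1 y0 - sysG Sys i *m stack i y0 y1; last first.
  by split=> [/subr0_eq//|->]; rewrite subrr.
have stackE : stack i y1 y0 =
    \col_k \sum_l (k == l)%:R * (if (l < sysm Sys i)%N then y1 l 0 else y0 l 0).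
  apply/colP => k; rewrite !mxE (bigD1 k)//= eqxx mul1r big1 ?addr0// => l.
  by rewrite eq_sym => /negPf ->; rewrite mul0r.
rewrite stackE /B; apply/colP => k; rewrite !mxE -big_split/= -sumrB.
apply: eq_bigr => l _; rewrite !mxE.
by case: ifP => _; rewrite mulNr// addrC.
Qed.

(** Weak solutions of the [i]-th mode on [a, T], tested at the final time [T]. *)
Definition weak_mode_sol (i : I) (a T : R) (y : R -> R -> 'cV[R]_n) : Prop :=
  forall phi dt dx : R -> R -> 'cV[R]_n,
  C1_rect a T phi dt dx ->
  (forall t : R, a <= t <= T ->
    Lamp i *m stack i (phi t 0) (phi t 1) =
    (sysG Sys i)^T *m Lamp i *m stack i (phi t 1) (phi t 0)) ->
  \int[mu]_(x in `]0, 1[) dotv (phi T x) (y T x) -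
  \int[mu]_(x in `]0, 1[) dotv (phi a x) (y a x) =
  \int[mu]_(t in `[a, T]) \int[mu]_(x in `]0, 1[)
    dotv (dt t x + Lam i *m dx t x + (sysF i)^T *m phi t x) (y t x).

(** [a] ranges over the initial time and the switching times, and [T > a] over
    the times up to the next switching time, if any. *)
Definition weak_sol (sigma : R -> I) (w0 : R -> 'cV[R]_n)
    (w : R -> R -> 'cV[R]_n) : Prop :=
  [/\ C0L2 w,
      w 0 = w0 %[ae mu in `]0, 1[%classic]
    & forall a T : R, a = 0 \/ switching_time sigma a -> a < T ->
        (forall s : R, a < s < T -> ~ switching_time sigma s) ->
        weak_mode_sol (sigma a) a T
          (fun t x => sysS Sys (sigma a) *m w t x)].

Definition GUES (Sig : set (R -> I)) : Prop :=
  exists nu C : R, [/\ 0 < nu, 0 < C &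
    forall (w0 : R -> 'cV[R]_n) (sigma : R -> I), L2 w0 -> Sig sigma ->
    forall w, weak_sol sigma w0 w ->
    forall t : R, 0 <= t ->
      (L2norm (w t) <= (C * expR (- nu * t))%:E * L2norm w0)%E].

End system.

(* Main.v *)
(* On an interval where mode [i] is active, write [E(y)] for the integral of
   [y^T Q_i y] and [E*(phi)] for that of [phi^T Q_i^-1 phi]. Testing the weak
   formulation with time-independent [phi] in the domain of the dual operator
   [A* phi = Lambda phi' + F^T phi] gives [d/dt <phi, y> = <A* phi, y>]. The
   backward dual problem is discretized by a semi-implicit Euler scheme
   [chi - h Lambda chi' = psi + h F^T psi]: each step is a two-point boundary
   value problem for decoupled scalar equations, it contracts [E*] by the factor
   [1 - nu h], and the discrete time derivatives obey the same recursion, hence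
   stay bounded. Therefore [<psi, y(T)>] and [<phi, y(a)>], with [phi] the last
   iterate started from [psi], differ by a quantity vanishing with [h], and
   [2 <psi, y(T)> <= E*(psi) + exp(- nu (T - a)) E(y(a))]. By density [psi] can
   approach [Q_i y(T)], which yields the decay of [E] without any regularity of
   the weak solution. The energy expressed in [w] is the same for all modes, so
   that the decays on the successive intervals multiply. *)
Require Import Defs.
From mathcomp Require Import all_boot all_order all_algebra.
From mathcomp Require Import all_classical all_reals all_analysis.
From mathcomp Require Import measurable_realfun ring lra.
Import Order.TTheory GRing.Theory Num.Theory.
Import numFieldNormedType.Exports.
Local Open Scope ring_scope.
Local Open Scope classical_set_scope.

Set Implicit Arguments.
Unset Strict Implicit.
Unset Printing Implicit Defensive.

(** * Square integrable functions on the unit interval *)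

Section square_integrable.
Context {R : realType}.
Notation mu := (@lebesgue_measure R).
Notation U := (`]0, 1[%classic : set R).
Implicit Types f g : R -> R.

Definition sqint f :=
  measurable_fun U f /\ mu.-integrable U (EFin \o (fun x => f x ^+ 2)).

Lemma unit_measurable : measurable U. Proof. exact: measurable_itv. Qed.
Hint Resolve unit_measurable : core.

Lemma unit_measure : mu U = 1%E.
Proof. by rewrite lebesgue_measure_itv/= lte_fin ltr01 oppr0 adde0. Qed.

Lemma integrable_EFinD (D : set R) f g : measurable D ->
  mu.-integrable D (EFin \o f) -> mu.-integrable D (EFin \o g) ->
  mu.-integrable D (EFin \o (fun x => f x + g x)).
Proof.
move=> mD if_ ig; have -> : EFin \o (fun x => f x + g x) = (EFin \o f) \+ (EFin \o g).
  by apply/funext => x /=; rewrite EFinD.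
exact: integrableD.
Qed.

Lemma integrable_EFinZ (D : set R) c f : measurable D ->
  mu.-integrable D (EFin \o f) -> mu.-integrable D (EFin \o (fun x => c * f x)).
Proof.
move=> mD if_; have -> : EFin \o (fun x => c * f x) =
    (fun x => (c%:E * ((EFin \o f) x))%E).
  by apply/funext => x /=; rewrite EFinM.
exact: integrableZl.
Qed.

Lemma integrable_EFin_norm (D : set R) f : measurable D ->
  mu.-integrable D (EFin \o f) -> mu.-integrable D (EFin \o (fun x => `|f x|)).
Proof.
move=> mD if_; have mf := measurable_int mu if_; apply: le_integrable if_ => //.
  apply/measurable_EFinP; apply: measurableT_comp => //.
  exact/measurable_EFinP.
by move=> x _ /=; rewrite lee_fin normr_id.
Qed.

Lemma integrable_dominated f g : measurable_fun U f ->
  mu.-integrable U (EFin \o g) -> (forall x, `|f x| <= g x) ->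
  mu.-integrable U (EFin \o f).
Proof.
move=> mf ig fg; apply: le_integrable ig => //; first exact/measurable_EFinP.
by move=> x _ /=; rewrite lee_fin; apply: le_trans (fg x) (ler_norm _).
Qed.

Lemma sqint_mul f g : sqint f -> sqint g ->
  mu.-integrable U (EFin \o (fun x => f x * g x)).
Proof.
move=> [mf if2] [mg ig2].
apply: (@integrable_dominated _ (fun x => f x ^+ 2 + g x ^+ 2)).
- exact: measurable_funM.
- exact: integrable_EFinD.
- move=> x; rewrite ler_norml; apply/andP; split.
  + have := sqr_ge0 (f x + g x); have := sqr_ge0 (f x); have := sqr_ge0 (g x); nra.
  + have := sqr_ge0 (f x - g x); have := sqr_ge0 (f x); have := sqr_ge0 (g x); nra.
Qed.

Lemma sqintD f g : sqint f -> sqint g -> sqint (fun x => f x + g x).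
Proof.
move=> sf sg; have fg := sqint_mul sf sg.
case: sf sg => mf if2 [mg ig2]; split; first exact: measurable_funD.
have -> : EFin \o (fun x => (f x + g x) ^+ 2) =
    EFin \o (fun x => f x ^+ 2 + (2 * (f x * g x) + g x ^+ 2)).
  by apply/funext => x /=; congr EFin; ring.
by do !apply: integrable_EFinD => //; apply: integrable_EFinZ.
Qed.

Lemma sqintZ c f : sqint f -> sqint (fun x => c * f x).
Proof.
move=> [mf if2]; split; first exact: measurable_funM.
have -> : EFin \o (fun x => (c * f x) ^+ 2) =
    EFin \o (fun x => c ^+ 2 * f x ^+ 2).
  by apply/funext => x /=; rewrite exprMn.
exact: integrable_EFinZ.
Qed.

Lemma sqint_sum (I : finType) (f : I -> R -> R) :
  (forall i, sqint (f i)) -> sqint (fun x => \sum_i f i x).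
Proof.
move=> sf; have -> : (fun x => \sum_i f i x) = \sum_i f i.
  by apply/funext => x; rewrite fct_sumE.
apply: (big_ind sqint) => //; last by move=> g h; exact: sqintD.
split; first exact: measurable_cst.
have -> : EFin \o (fun x => (0 : R -> R) x ^+ 2) = cst 0%E.
  by apply/funext => x /=; rewrite expr0n.
exact: integrable0.
Qed.

Lemma sqint_bounded f M : measurable_fun U f -> (forall x, U x -> `|f x| <= M) ->
  sqint f.
Proof.
move=> mf fM; split=> //; apply: measurable_bounded_integrable => //.
- by have /= -> := unit_measure; rewrite ltry.
- exact: measurable_funX.
- exists (M ^+ 2); split; first exact: num_real.
  move=> r Mr x Ux; apply: le_trans (ltW Mr); rewrite normrX.
  by rewrite ler_sqr ?nnegrE ?fM// (le_trans _ (fM x Ux)).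
Qed.

Lemma continuous_bounded f (a b : R) : continuous f ->
  exists M : R, forall x : R, a <= x <= b -> `|f x| <= M.
Proof.
move=> cf; have : compact (f @` `[a, b]).
  by apply: continuous_compact; [exact: continuous_subspaceT|exact: segment_compact].
move=> /compact_bounded[M [_ fM]]; exists (M + 1) => x xab.
by apply: (fM (M + 1)); [rewrite ltrDl|exists x; rewrite /= ?in_itv].
Qed.

Lemma continuous_sqint f : continuous f -> sqint f.
Proof.
move=> cf; have [M fM] := continuous_bounded 0 1 cf.
apply: (@sqint_bounded _ M).
  by apply: measurable_funTS; exact: continuous_measurable_fun.
by move=> x /=; rewrite in_itv/= => /andP[x0 x1]; apply: fM; rewrite !ltW.
Qed.

Lemma Lfun2_sqint f : (f \_ U) \in Lfun mu 2%:E -> sqint f.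
Proof.
move=> L2f; split.
  move: L2f; rewrite inE => /andP[/[!inE]/= mf _].
  by apply/(measurable_restrictT _ _).2.
have := Lfun2_integrable_sqr L2f.
have -> : EFin \o (fun x => (f \_ U) x ^+ 2) =
    (EFin \o (fun x => f x ^+ 2)) \_ U.
  by apply/funext => x /=; rewrite !patchE; case: ifP; rewrite // expr0n.
by move=> ?; apply/integrable_mkcond.
Qed.

End square_integrable.
#[global] Hint Resolve unit_measurable : core.

Section vector_valued.
Context {R : realType} {n : nat}.
Notation mu := (@lebesgue_measure R).
Notation U := (`]0, 1[%classic : set R).
Implicit Types (u v w : R -> 'cV[R]_n) (M : 'M[R]_n).

Lemma dotvE (a b : 'cV[R]_n) : dotv a b = \sum_k a k 0 * b k 0.
Proof. by rewrite /dotv mxE; apply: eq_bigr => k _; rewrite mxE. Qed.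

Definition sqintv u := forall k, sqint (fun x => u x k 0).

Definition ip u v : R := \int[mu]_(x in U) dotv (u x) (v x).

Lemma sqintvD u v : sqintv u -> sqintv v -> sqintv (fun x => u x + v x).
Proof.
move=> su sv k; have := sqintD (su k) (sv k).
by congr sqint; apply/funext => x; rewrite mxE.
Qed.

Lemma sqintvZ c u : sqintv u -> sqintv (fun x => c *: u x).
Proof.
by move=> su k; have := sqintZ c (su k); congr sqint; apply/funext => x; rewrite mxE.
Qed.

Lemma sqintvB u v : sqintv u -> sqintv v -> sqintv (fun x => u x - v x).
Proof.
move=> su sv; have := sqintvD su (sqintvZ (-1) sv).
by congr sqintv; apply/funext => x; rewrite scaleN1r.
Qed.

Lemma sqintvM M u : sqintv u -> sqintv (fun x => M *m u x).
Proof.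
move=> su k; have := sqint_sum (fun j => sqintZ (M k j) (su j)).
by congr sqint; apply/funext => x; rewrite mxE.
Qed.

Lemma integrable_dotv u v : sqintv u -> sqintv v ->
  mu.-integrable U (EFin \o (fun x => dotv (u x) (v x))).
Proof.
move=> su sv.
have -> : EFin \o (fun x => dotv (u x) (v x)) =
    (fun x => \sum_(k <- enum 'I_n) 
        (EFin \o (fun z => (u z k 0 * v z k 0)%R)) x)%E.
  by apply/funext => x /=; rewrite dotvE sumEFin big_enum.
by apply: integrable_sum => // k _; exact: sqint_mul.
Qed.

Lemma dotvC (a b : 'cV[R]_n) : dotv a b = dotv b a.
Proof. by rewrite !dotvE; apply: eq_bigr => k _; rewrite mulrC. Qed.

Lemma dotvDl (a b c : 'cV[R]_n) : dotv (a + b) c = dotv a c + dotv b c.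
Proof. by rewrite /dotv linearD mulmxDl mxE. Qed.

Lemma dotvZl (a b : 'cV[R]_n) c : dotv (c *: a) b = c * dotv a b.
Proof. by rewrite /dotv linearZ/= -scalemxAl mxE. Qed.

Lemma dotvM M (a b : 'cV[R]_n) : dotv (M *m a) b = dotv a (M^T *m b).
Proof. by rewrite /dotv trmx_mul mulmxA. Qed.

Lemma ipC u v : ip u v = ip v u.
Proof. by apply: eq_Rintegral => x _; rewrite dotvC. Qed.

Lemma ipDl u v w : sqintv u -> sqintv v -> sqintv w ->
  ip (fun x => u x + v x) w = ip u w + ip v w.
Proof.
move=> su sv sw; rewrite /ip -RintegralD//; [|exact: integrable_dotv..].
by apply: eq_Rintegral => x _; rewrite dotvDl.
Qed.

Lemma ipZl c u v : sqintv u -> sqintv v ->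
  ip (fun x => c *: u x) v = c * ip u v.
Proof.
move=> su sv; rewrite /ip -RintegralZl//; last exact: integrable_dotv.
by apply: eq_Rintegral => x _; rewrite dotvZl.
Qed.

Lemma ipM M u v : ip (fun x => M *m u x) v = ip u (fun x => M^T *m v x).
Proof. by apply: eq_Rintegral => x _; rewrite dotvM. Qed.

Lemma ipBl u v w : sqintv u -> sqintv v -> sqintv w ->
  ip (fun x => u x - v x) w = ip u w - ip v w.
Proof.
move=> su sv sw; rewrite -mulN1r -ipZl// -ipDl//; last exact: sqintvZ.
by congr ip; apply/funext => x; rewrite scaleN1r.
Qed.

Lemma ipBr u v w : sqintv u -> sqintv v -> sqintv w ->
  ip u (fun x => v x - w x) = ip u v - ip u w.
Proof. by move=> su sv sw; rewrite ipC ipBl// !(ipC u). Qed.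

Lemma ipZr c u v : sqintv u -> sqintv v ->
  ip u (fun x => c *: v x) = c * ip u v.
Proof. by move=> su sv; rewrite ipC ipZl// ipC. Qed.

Lemma ip_le u v u' v' : sqintv u -> sqintv v -> sqintv u' -> sqintv v' ->
  (forall x, dotv (u x) (v x) <= dotv (u' x) (v' x)) -> ip u v <= ip u' v'.
Proof.
by move=> su sv su' sv' uv; apply: le_Rintegral => //; exact: integrable_dotv.
Qed.

Lemma ip_ge0 u v : (forall x, 0 <= dotv (u x) (v x)) -> 0 <= ip u v.
Proof. by move=> uv; exact: Rintegral_ge0. Qed.

End vector_valued.

Section calculus.
Context {R : realType}.
Notation mu := (@lebesgue_measure R).
Notation U := (`]0, 1[%classic : set R).
Implicit Types f g : R -> R.

Lemma is_derive_mul f g (x a b : R) : is_derive x 1 f a -> is_derive x 1 g b ->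
  is_derive x 1 (fun y => f y * g y) (a * g x + f x * b).
Proof.
move=> df dg; apply: is_derive_eq (is_deriveM df dg) _.
by rewrite /GRing.scale/=; ring.
Qed.

Lemma is_derive_scale f (c x a : R) : is_derive x 1 f a ->
  is_derive x 1 (fun y => c * f y) (c * a).
Proof. by move=> df; exact: is_deriveZ. Qed.

Lemma is_derive_add f g (x a b : R) : is_derive x 1 f a -> is_derive x 1 g b ->
  is_derive x 1 (fun y => f y + g y) (a + b).
Proof. by move=> df dg; exact: is_deriveD. Qed.

Lemma is_derive_sub f g (x a b : R) : is_derive x 1 f a -> is_derive x 1 g b ->
  is_derive x 1 (fun y => f y - g y) (a - b).
Proof. by move=> df dg; exact: is_deriveB. Qed.

Lemma is_derive_continuous f (x a : R) : is_derive x 1 f a -> {for x, continuous f}.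
Proof. by move=> [df _]; apply/differentiable_continuous/derivable1_diffP. Qed.

Lemma primitive f : continuous f ->
  exists2 F : R -> R, continuous F & forall x : R, 0 < x -> is_derive x 1 F (f x).
Proof.
move=> cf; pose F y := \int[mu]_(t in `[-1, y]) f t.
have dF (x : R) : -1 < x -> is_derive x 1 F (f x).
  move=> x1.
  have [] := @continuous_FTC1_closed R f (-1) x (x + 1) _ _ x1 (cf x).
  - by rewrite ltrDl.
  - apply: continuous_compact_integrable; first exact: segment_compact.
    exact: continuous_subspaceT.
  - move=> dF <-; rewrite derive1E; exact: derivableP.
exists (fun x => F (Num.max x (- 2^-1))) => [x|x x0].
  apply: (@continuous_comp R R R (fun x => Num.max x (- 2^-1)) F x).
    by apply: (@continuous_max _ R id (cst (- 2^-1))) => //; exact: cvg_cst.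
  by apply: is_derive_continuous (dF _ _); rewrite lt_max; apply/orP; right; lra.
apply: near_eq_is_derive (dF x _); last lra.
near=> y; rewrite max_l//; suff : 0 < y by lra.
by near: y; exact: lt_nbhsr.
Unshelve. all: by end_near. Qed.

Lemma unit_FTC2 f F : continuous f -> continuous F ->
  (forall x : R, 0 < x < 1 -> is_derive x 1 F (f x)) ->
  \int[mu]_(x in U) f x = F 1 - F 0.
Proof.
move=> cf cF dF.
have fi : mu.-integrable `[0, 1] (EFin \o f).
  apply: continuous_compact_integrable; first exact: segment_compact.
  exact: continuous_subspaceT.
rewrite Rintegral_itv_bndo_bndc ?Rintegral_itv_obnd_cbnd//; last 2 first.
- by apply: integrableS fi => //; exact: subset_itv_oc_cc.
- by apply: integrableS fi => //; exact: subset_itv_oo_cc.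
rewrite /Rintegral (@continuous_FTC2 R f F 0 1)//.
- exact: continuous_subspaceT.
- split=> [x /[!in_itv]/= x01||]; first by have [] := dF x x01.
  + exact/cvg_at_right_filter/cF.
  + exact/cvg_at_left_filter/cF.
- by move=> x /[!in_itv]/= x01; rewrite derive1E; have [] := dF x x01.
Qed.

End calculus.

Section density.
Context {R : realType}.
Notation mu := (@lebesgue_measure R).
Notation U := (`]0, 1[%classic : set R).
Implicit Types f g : R -> R.

Definition sqdist f g : R := \int[mu]_(x in U) (f x - g x) ^+ 2.

Lemma integrable_sqB f g : sqint f -> sqint g ->
  mu.-integrable U (EFin \o (fun x => (f x - g x) ^+ 2)).
Proof.
move=> sf sg; have [_] := sqintD sf (sqintZ (-1) sg).
by congr (integrable _ _ _); apply/funext => x /=; rewrite mulN1r.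
Qed.

Lemma sqdist_triangle f g h : sqint f -> sqint g -> sqint h ->
  sqdist f h <= 2 * (sqdist f g + sqdist g h).
Proof.
move=> sf sg sh; rewrite /sqdist.
have ifg := integrable_sqB sf sg; have igh := integrable_sqB sg sh.
rewrite -RintegralD// -RintegralZl//; last first.
  exact: integrable_EFinD.
apply: le_Rintegral => //; first exact: integrable_sqB.
  by apply: integrable_EFinZ => //; exact: integrable_EFinD.
by move=> x _; have := sqr_ge0 (f x - g x - (g x - h x)); nra.
Qed.

Lemma sqdist_cvg (f_ : nat -> R -> R) f (D : R -> R) :
  (forall n, sqint (f_ n)) -> sqint f ->
  mu.-integrable U (EFin \o D) ->
  (forall x, U x -> f_ n x @[n --> \oo] --> f x) ->
  (forall n x, U x -> (f x - f_ n x) ^+ 2 <= D x) ->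
  forall e, (0 : R) < e -> exists n, sqdist f (f_ n) < e.
Proof.
move=> sf_ sf iD cf_ dom e e0.
have [x Ux|x n Ux|_ _ h] := @dominated_convergence _ _ _ mu U unit_measurable
  (fun n => EFin \o (fun x => (f x - f_ n x) ^+ 2)) (cst 0%E) (EFin \o D)
  (fun n => measurable_int mu (integrable_sqB sf (sf_ n)))
  (measurable_cst _) (aeW mu _) iD (aeW mu _).
- apply: cvg_EFin; first exact: nearW.
  rewrite (_ : 0 = (f x - f x) * (f x - f x) :> R); last by rewrite subrr mul0r.
  by apply: cvgM; apply: cvgB; [exact: cvg_cst|exact: cf_|exact: cvg_cst|exact: cf_].
- by rewrite /= lee_fin ger0_norm ?sqr_ge0// dom.
rewrite integral0 in h.
have /fine_cvgP[_] := h.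
move=> /cvgr_lt /(_ _ e0) [N _ /(_ N (leqnn N))] => ?; exists N.
exact.
Qed.

Lemma sqint_cst0 : sqint (cst 0 : R -> R).
Proof. by apply: continuous_sqint => x; exact: cvg_cst. Qed.

Definition vanishing_C1 (p dp : R -> R) :=
  [/\ continuous p, continuous dp,
      forall x : R, 0 < x < 1 -> is_derive x 1 p (dp x), p 0 = 0 & p 1 = 0].

Definition approximable f := forall e : R, 0 < e ->
  exists p dp, vanishing_C1 p dp /\ sqdist f p < e.

Lemma approximable_closed f : sqint f ->
  (forall e : R, 0 < e -> exists g, [/\ sqint g, approximable g & sqdist f g < e]) ->
  approximable f.
Proof.
move=> sf cl e e0; have e40 : 0 < e / 4 by rewrite divr_gt0.
have [g [sg ag fg]] := cl _ e40; have [p [dp [pC1 gp]]] := ag _ e40.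
exists p, dp; split=> //; case: pC1 => cp _ _ _ _.
apply: le_lt_trans (sqdist_triangle sf sg (continuous_sqint cp)) _.
by move: fg gp; lra.
Qed.

Lemma continuous_shift f (a : R) : continuous f -> continuous (fun x : R => f (x + a)).
Proof.
move=> cf x; apply: (@continuous_comp R R R (fun x : R => x + a) f x); last exact: cf.
by apply: cvgD; [exact: cvg_id|exact: cvg_cst].
Qed.

Lemma continuous_difference f (a b : R) : continuous f ->
  continuous (fun x : R => b * (f (x + a) - f x)).
Proof.
move=> cf x; apply: cvgM; first exact: cvg_cst.
by apply: cvgB; [exact: continuous_shift|exact: cf].
Qed.

Lemma continuous_approximable f : continuous f -> approximable f.
Proof.
move=> cf e e0; have [F cF dF] := primitive cf.
have [M fM] := continuous_bounded 0 2 cf.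
pose q (n : nat) (x : R) : R := n.+1%:R * (F (x + n.+1%:R^-1) - F x).
pose dq (n : nat) (x : R) : R := n.+1%:R * (f (x + n.+1%:R^-1) - f x).
pose P n : {poly R} := 1 - (2%:P * 'X - 1) ^+ n.*2.
pose c (n : nat) (x : R) := (P n).[x]; pose dc (n : nat) (x : R) := ((P n)^`()).[x].
have cE n x : c n x = 1 - (2 * x - 1) ^+ n.*2 by rewrite /c !hornerE.
pose p n x := c n x * q n x.
pose dp n x := c n x * dq n x + dc n x * q n x.
have dcE n (x : R) : is_derive x 1 (c n) (dc n x) by exact: is_derive_poly.
have cc n : continuous (c n) by move=> x; exact: is_derive_continuous (dcE n x).
have cdc n : continuous (dc n).
  by move=> x; apply: is_derive_continuous (is_derive_poly _ _).
have cp n : continuous (p n).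
  by move=> x; apply: cvgM; [exact: cc|exact: continuous_difference].
have C1 n : vanishing_C1 (p n) (dp n).
  split=> [//|x|x /andP[x0 x1]||].
  - apply: cvgD; apply: cvgM; 
      [exact: cc|exact: continuous_difference|exact: cdc|exact: continuous_difference].
  - have xn0 : 0 < x + n.+1%:R^-1 by rewrite addr_gt0 ?invr_gt0.
    have dF2 : is_derive x 1 (fun y : R => F (y + n.+1%:R^-1)) (f (x + n.+1%:R^-1)).
      have dxn : is_derive x 1 (fun y : R => y + n.+1%:R^-1) (1 + 0).
        exact: is_derive_add.
      have := is_derive1_comp
        (dF _ xn0 : is_derive ((fun y : R => y + n.+1%:R^-1) x) 1 F _) dxn.
      by rewrite addr0 mulr1.
    have := is_derive_mul (dcE n x)
      (is_derive_scale n.+1%:R (is_derive_sub dF2 (dF _ x0))).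
    by rewrite addrC.
  - by rewrite /p cE mulr0 sub0r -mul2n exprM sqrrN expr1n expr1n subrr mul0r.
  - by rewrite /p cE (_ : 2 * 1 - 1 = 1 :> R) ?expr1n ?subrr ?mul0r//; ring.
have M0 : 0 <= M by rewrite (le_trans _ (fM 0 _))// lexx ler0n.
have qM n x : 0 < x < 1 -> `|q n x| <= M.
  move=> /andP[x0 x1]; rewrite /q.
  have n0 : 0 < n.+1%:R^-1 :> R by rewrite invr_gt0.
  have n1 : n.+1%:R^-1 <= 1 :> R by rewrite invf_le1// ler1n.
  have [y /[!in_itv]/= /andP[xy yn] ->] : exists2 y, y \in `]x, x + n.+1%:R^-1[%R &
      F (x + n.+1%:R^-1) - F x = f y * (x + n.+1%:R^-1 - x).
    apply: MVT; first by rewrite ltrDl.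
      by move=> y /[!in_itv]/= /andP[xy _]; apply: dF; lra.
    exact: continuous_subspaceT.
  rewrite (addrC x) addrK mulrCA mulfV ?mulr1; last by rewrite pnatr_eq0.
  apply: fM; rewrite (le_trans (ltW x0) (ltW xy))/= (le_trans (ltW yn))//.
  by rewrite (_ : 2 = 1 + 1)// lerD// ltW.
have pM n x : 0 < x < 1 -> `|p n x| <= M.
  move=> x01; rewrite /p normrM -[leRHS]mul1r ler_pM ?qM// cE.
  have /andP[x0 x1] := x01.
  have : (2 * x - 1) ^+ 2 <= 1 by nra.
  have := sqr_ge0 (2 * x - 1); rewrite -mul2n exprM.
  move: (_ ^+ 2) => z z0 z1; rewrite ger0_norm; last by rewrite subr_ge0 exprn_ile1.
  by rewrite lerBlDr lerDl exprn_ge0.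
have [||n x|n fp] := @sqdist_cvg p f (cst ((2 * M) ^+ 2))
  (fun n => continuous_sqint (cp n)) (continuous_sqint cf) _ _ _ _ e0.
- by have [] := continuous_sqint (fun x => @cvg_cst _ (2 * M) _ (nbhs x) _).
- move=> x /=; rewrite in_itv/= => x01.
  have -> : f x = 1 * f x by rewrite mul1r.
  apply: cvgM.
    rewrite (_ : c ^~ x = fun n => 1 - ((2 * x - 1) ^+ 2) ^+ n); last first.
      by apply/funext => n; rewrite cE -mul2n exprM.
    rewrite -[X in _ --> X]subr0; apply: cvgB; first exact: cvg_cst.
    apply: cvg_expr; rewrite ger0_norm ?sqr_ge0//.
    by move: x01 => /andP[x0 x1]; nra.
  have x0 : 0 < x by case/andP: x01.
  have [dFx dFE] := dF _ x0.
  have /cvg_dnbhs_at_right/cvg_at_rightP quot :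
      (fun h : R => h^-1 *: ((F \o shift x) (h *: 1) - F x)) @ 0^' --> f x.
    by rewrite -dFE; exact: dFx.
  have := quot (fun n => n.+1%:R^-1) _.
  rewrite (_ : q ^~ x = fun n => n.+1%:R^-1^-1 *:
      ((F \o shift x) (n.+1%:R^-1 *: 1) - F x)); last first.
    by apply/funext => n; rewrite /q invrK /GRing.scale/= mulr1 (addrC x).
  apply; split; [by move=> n; rewrite invr_gt0|exact: cvg_harmonic].
- rewrite /= in_itv/= => x01; rewrite -[leLHS]real_normK ?num_real// ler_sqr ?nnegrE//.
    by rewrite (le_trans (ler_normB _ _))// mulrDl mul1r lerD ?pM// fM//; lra.
  by rewrite mulr_ge0.
- by exists (p n), (dp n).
Qed.

Lemma clamp_bounded (m z : R) : 0 <= m -> `|Num.max (- m) (Num.min m z)| <= m.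
Proof. by move=> m0; rewrite ler_norml le_max lexx/= ge_max ge_min lexx; lra. Qed.

Lemma clamp_id (m z : R) : `|z| <= m -> Num.max (- m) (Num.min m z) = z.
Proof. by rewrite ler_norml => /andP[mz zm]; rewrite (min_r zm) (max_r mz). Qed.

Lemma clamp_lipschitz (m y z : R) :
  `|Num.max (- m) (Num.min m y) - Num.max (- m) (Num.min m z)| <= `|y - z|.
Proof.
rewrite /Num.max /Num.min.
have [] := ltP m y; have [] := ltP m z; have [] := ltP (- m) y;
  have [] := ltP (- m) z; have [] := ltP (- m) m => *;
  rewrite ler_norml; have := ler_norm (y - z); have := ler_norm (z - y);
  rewrite (distrC z); move: (`|_|) => r *; apply/andP; split; lra.
Qed.

Lemma clamp_dist (m z : R) : 0 <= m -> `|z - Num.max (- m) (Num.min m z)| <= `|z|.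
Proof.
move=> m0; rewrite /Num.max /Num.min.
have [] := ltP m z; have [] := ltP (- m) z; have [] := ltP (- m) m => *;
  rewrite ler_norml; have := ler_norm z; have := ler_norm (- z);
  rewrite normrN; move: (`|_|) => r *; apply/andP; split; lra.
Qed.

Lemma bounded_approximable f m : 0 <= m -> measurable_fun U f ->
  (forall x, U x -> `|f x| <= m) -> approximable f.
Proof.
move=> m0 mf fm; have sf := sqint_bounded mf fm.
apply: approximable_closed => // e e0.
have if1 : mu.-integrable U (EFin \o f).
  have := sqint_mul sf (continuous_sqint (fun x => @cvg_cst _ (1 : R) _ (nbhs x) _)).
  move=> h; have -> : f = fun x => f x * cst 1 x by apply/funext => x; rewrite mulr1.
  exact: h.
have Ufin : (mu U < +oo)%E by have /= -> := @unit_measure R; rewrite ltry.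
have [g_ [cg ig gf]] := approximation_continuous_integrable unit_measurable Ufin if1.
have m1 : 0 < 2 * m + 1 by rewrite ltr_wpDl// mulr_ge0.
have e0' : 0 < e / (2 * m + 1) by rewrite divr_gt0.
have [n _ /(_ n (leqnn n)) /= gn] : \forall n \near \oo,
    fine (\int[mu]_(z in U) `|(f z - g_ n z)%:E|)%E < e / (2 * m + 1).
  have /fine_cvgP[_ /cvgr_lt] := gf; exact.
pose g x := Num.max (- m) (Num.min m (g_ n x)).
have gc : continuous g.
  move=> x; apply: (@continuous_max _ R (cst (- m)) (fun x => Num.min m (g_ n x))).
    exact: cvg_cst.
  apply: (@continuous_min _ R (cst m) (g_ n)); first exact: cvg_cst.
  exact: cg.
exists g; split; [exact: continuous_sqint|exact: continuous_approximable|].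
have ifg : mu.-integrable U (EFin \o (fun x => `|f x - g_ n x|)).
  apply: integrable_EFin_norm => //.
  have := integrable_EFinD unit_measurable if1
    (integrable_EFinZ (-1) unit_measurable (ig n)).
  rewrite (_ : (fun x => f x + -1 * g_ n x) = fun x => f x - g_ n x)//.
  by apply/funext => x; rewrite mulN1r.
have : sqdist f g <= 2 * m * \int[mu]_(x in U) `|f x - g_ n x|.
  rewrite -RintegralZl//; apply: le_Rintegral => //.
  - exact: integrable_sqB (continuous_sqint gc).
  - exact: integrable_EFinZ.
  move=> x Ux; rewrite -[leLHS]real_normK ?num_real// expr2 ler_pM//.
    by rewrite (le_trans (ler_normB _ _))// mulrDl mul1r lerD ?fm// clamp_bounded.
  by rewrite -{1}(clamp_id (fm x Ux)) clamp_lipschitz.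
move=> /le_lt_trans; apply.
have : 2 * m * \int[mu]_(x in U) `|f x - g_ n x| <= (2 * m) * (e / (2 * m + 1)).
  by rewrite ler_wpM2l ?mulr_ge0// ltW.
move=> /le_lt_trans; apply.
by rewrite mulrA ltr_pdivrMr// mulrC ltr_pM2l//; lra.
Qed.

Theorem sqint_approximable f : sqint f -> approximable f.
Proof.
move=> sf; apply: approximable_closed => // e e0.
pose f_ n x := Num.max (- n%:R) (Num.min n%:R (f x)).
have mf_ n : measurable_fun U (f_ n).
  have [mf _] := sf.
  have := measurable_maxr (measurable_cst (- n%:R : R))
    (measurable_minr (measurable_cst (n%:R : R)) mf).
  exact.
have bf_ n x : `|f_ n x| <= n%:R by apply: clamp_bounded.
have sf_ n : sqint (f_ n) by apply: (@sqint_bounded _ _ n%:R).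
have [_ if2] := sf.
have [x Ux|n x Ux|n fn] := sqdist_cvg sf_ sf if2 _ _ e0.
- apply: cvg_near_cst; exists (Num.truncn `|f x|).+1 => // n /= xn.
  rewrite /f_ clamp_id// (le_trans (ltW (truncnS_gt _)))// ler_nat//.
- rewrite -[leLHS]real_normK ?num_real// -[leRHS]real_normK ?num_real//.
  by rewrite ler_sqr ?nnegrE// clamp_dist.
- exists (f_ n); split=> //; exact: (@bounded_approximable _ n%:R).
Qed.
End density.

(** * Weighted energies *)

Section weighted_forms.
Context {R : realType} {n : nat}.
Implicit Types (d e : 'rV[R]_n) (a b v : 'cV[R]_n) (M N : 'M[R]_n).

Definition positive_row e := forall k, 0 < e 0 k.

Definition invrow e : 'rV[R]_n := \row_k (e 0 k)^-1.

Lemma invrow_positive e : positive_row e -> positive_row (invrow e).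
Proof. by move=> e0 k; rewrite mxE invr_gt0. Qed.

Lemma diag_mulE e v k : (diag_mx e *m v) k 0 = e 0 k * v k 0.
Proof. by rewrite mul_diag_mx mxE. Qed.

Lemma dotv_diag e a b : dotv a (diag_mx e *m b) = \sum_k e 0 k * (a k 0 * b k 0).
Proof. by rewrite dotvE; apply: eq_bigr => k _; rewrite diag_mulE mulrCA. Qed.

Lemma dotv_diagsq e v : dotv v (diag_mx e *m v) = \sum_k e 0 k * v k 0 ^+ 2.
Proof. by rewrite dotv_diag; under eq_bigr do rewrite -expr2. Qed.

Lemma dotv_diag_ge0 e v : positive_row e -> 0 <= dotv v (diag_mx e *m v).
Proof.
move=> e0; rewrite dotv_diagsq; apply: sumr_ge0 => k _.
by rewrite mulr_ge0 ?sqr_ge0// ltW.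
Qed.

Lemma dotv_diagC e a b : dotv a (diag_mx e *m b) = dotv b (diag_mx e *m a).
Proof. by rewrite !dotv_diag; apply: eq_bigr => k _; rewrite [a k 0 * _]mulrC. Qed.

Lemma invrowK e v : positive_row e -> diag_mx e *m (diag_mx (invrow e) *m v) = v.
Proof.
by move=> e0; apply/colP => k; rewrite !diag_mulE mxE mulrA divff ?mul1r// gt_eqF.
Qed.

Lemma young_dotv e a b (c : R) : positive_row e -> 0 < c ->
  2 * dotv a b <=
  c * dotv a (diag_mx (invrow e) *m a) + c^-1 * dotv b (diag_mx e *m b).
Proof.
move=> e0 c0; rewrite !dotv_diagsq dotvE !mulr_sumr -big_split/=.
apply: ler_sum => k _; rewrite mxE; have ek := e0 k.
rewrite -subr_ge0; set D := (X in 0 <= X).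
have -> : D = (c * e 0 k)^-1 * (c * a k 0 - e 0 k * b k 0) ^+ 2.
  by rewrite /D; field; rewrite !gt_eqF.
by rewrite mulr_ge0 ?sqr_ge0// invr_ge0 mulr_ge0// ltW.
Qed.

Lemma form_bounded N e : positive_row e ->
  exists2 C, 0 < C & forall v, dotv v (N *m v) <= C * dotv v (diag_mx e *m v).
Proof.
move=> e0; pose C := \sum_k \sum_j `|N k j| * ((e 0 k)^-1 + (e 0 j)^-1).
have C0 : 0 <= C.
  apply: sumr_ge0 => k _; apply: sumr_ge0 => j _.
  by rewrite mulr_ge0// addr_ge0// invr_ge0 ltW.
exists (C + 1) => [|v]; first by rewrite ltr_wpDl.
have S0 := dotv_diag_ge0 v e0; set S := dotv v (diag_mx e *m v) in S0 *.
have vS k : v k 0 ^+ 2 <= (e 0 k)^-1 * S.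
  rewrite ler_pdivlMl// /S dotv_diagsq (bigD1 k)//= lerDl sumr_ge0// => j _.
  by rewrite mulr_ge0 ?sqr_ge0// ltW.
apply: (@le_trans _ _ (C * S)); last by rewrite ler_wpM2r// lerDl.
rewrite dotvE /C mulr_suml; apply: ler_sum => k _.
rewrite mxE mulr_sumr mulr_suml; apply: ler_sum => j _.
rewrite mulrCA -mulrA (le_trans (ler_norm _))// normrM ler_wpM2l//.
rewrite normrM mulrDl (le_trans _ (lerD (vS k) (vS j)))//.
rewrite -[v k 0 ^+ 2]real_normK ?num_real// -[v j 0 ^+ 2]real_normK ?num_real//.
have := sqr_ge0 (`|v k 0| - `|v j 0|).
have := sqr_ge0 (`|v k 0|); have := sqr_ge0 (`|v j 0|); nra.
Qed.

Lemma injective_unitmx M : (forall v, M *m v = 0 -> v = 0) -> M \in unitmx.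
Proof.
move=> inj; rewrite -unitmx_tr -row_free_unit -kermx_eq0; apply/eqP/row_matrixP => j.
rewrite row0; apply: trmx_inj; rewrite trmx0; apply: inj.
by apply: trmx_inj; rewrite trmx_mul trmxK -row_mul mulmx_ker row0 trmx0.
Qed.

Lemma lemx_dotv M N v : lemx M N -> dotv v (M *m v) <= dotv v (N *m v).
Proof.
move=> [_ /(_ v)]; rewrite -mulmxA -/(dotv _ _) mulmxBl.
by rewrite !(dotvC v) dotvDl -[in X in _ + X]scaleN1r dotvZl mulN1r subr_ge0.
Qed.

Lemma dual_contraction M e : positive_row e ->
  (forall v, dotv (M *m v) (diag_mx e *m (M *m v)) <= dotv v (diag_mx e *m v)) ->
  forall v, dotv (M^T *m v) (diag_mx (invrow e) *m (M^T *m v)) <=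
            dotv v (diag_mx (invrow e) *m v).
Proof.
move=> e0 contr s; set r := M^T *m s; pose v := diag_mx (invrow e) *m r.
have rE : diag_mx e *m v = r by rewrite /v invrowK.
have := contr v; rewrite rE -/v.
have := young_dotv s (M *m v) e0 (@ltr01 R).
have -> : dotv s (M *m v) = dotv r v by rewrite /r dotvM trmxK.
by rewrite (dotvC v r) invr1 !mul1r; lra.
Qed.

End weighted_forms.

Section C1_functions.
Context {R : realType} {n : nat}.
Notation U := (`]0, 1[%classic : set R).
Implicit Types u v du dv : R -> 'cV[R]_n.

Definition contv u := forall k, continuous (fun x => u x k 0).

Definition C1v u du := [/\ contv u, contv du &
  forall k (x : R), 0 < x < 1 -> is_derive x 1 (fun y => u y k 0) (du x k 0)].

Lemma contv_sqintv u : contv u -> sqintv u.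
Proof. by move=> cu k; exact: continuous_sqint. Qed.

Lemma contvD u v : contv u -> contv v -> contv (fun x => u x + v x).
Proof.
move=> cu cv k; rewrite (_ : (fun x => _) = fun x => u x k 0 + v x k 0).
  by move=> x; apply: cvgD; [exact: cu|exact: cv].
by apply/funext => x; rewrite mxE.
Qed.

Lemma contv_sum (f : 'I_n -> R -> R) : (forall k, continuous (f k)) ->
  continuous (fun x => \sum_k f k x).
Proof.
move=> cf; rewrite (_ : (fun x => _) = \sum_k f k).
  apply: (big_ind (fun g : R -> R => continuous g)) => //.
    by move=> x; exact: cvg_cst.
  by move=> g h cg ch x; apply: cvgD; [exact: cg|exact: ch].
by apply/funext => x; rewrite fct_sumE.
Qed.

Lemma is_derive_sumv (f df : 'I_n -> R -> R) (x : R) :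
  (forall k, is_derive x 1 (f k) (df k x)) ->
  is_derive x 1 (fun y => \sum_k f k y) (\sum_k df k x).
Proof.
move=> fd; rewrite (_ : (fun y => _) = \sum_k f k).
  exact: is_derive_sum.
by apply/funext => y; rewrite fct_sumE.
Qed.

Lemma contvM (M : 'M[R]_n) u : contv u -> contv (fun x => M *m u x).
Proof.
move=> cu k; rewrite (_ : (fun x => _) = fun x => \sum_j M k j * u x j 0).
  apply: contv_sum => j x; apply: cvgM; [exact: cvg_cst|exact: cu].
by apply/funext => x; rewrite mxE.
Qed.

Lemma contvZ (c : R) u : contv u -> contv (fun x => c *: u x).
Proof.
move=> cu; have := @contvM c%:M u cu.
by congr contv; apply/funext => x; rewrite mul_scalar_mx.
Qed.

Lemma C1v_scale (c : R) u du : C1v u du ->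
  C1v (fun x => c *: u x) (fun x => c *: du x).
Proof.
move=> [cu cdu du_]; split; [exact: contvZ|exact: contvZ|move=> k x x01].
rewrite (_ : (fun y => _) = fun y => c * u y k 0); last first.
  by apply/funext => y; rewrite mxE.
by rewrite mxE; apply: is_derive_scale; exact: du_.
Qed.

Lemma C1v_add u v du dv : C1v u du -> C1v v dv ->
  C1v (fun x => u x + v x) (fun x => du x + dv x).
Proof.
move=> [cu cdu du_] [cv cdv dv_]; split; [exact: contvD|exact: contvD|move=> k x x01].
rewrite (_ : (fun y => _) = fun y => u y k 0 + v y k 0); last first.
  by apply/funext => y; rewrite mxE.
by rewrite mxE; apply: is_derive_add; [exact: du_|exact: dv_].
Qed.

Lemma C1v_col (u du : 'I_n -> R -> R) :
  (forall k, continuous (u k)) -> (forall k, continuous (du k)) ->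
  (forall k (x : R), 0 < x < 1 -> is_derive x 1 (u k) (du k x)) ->
  C1v (fun x => \col_k u k x) (fun x => \col_k du k x).
Proof.
have colE (f : 'I_n -> R -> R) k : (fun x => (\col_j f j x) k 0) = f k.
  by apply/funext => x; rewrite mxE.
move=> cu cdu du_; split=> [k|k|k x x01]; rewrite ?colE ?mxE;
  [exact: cu|exact: cdu|exact: du_].
Qed.

End C1_functions.

Section energies.
Context {R : realType} {n : nat}.
Notation mu := (@lebesgue_measure R).
Notation U := (`]0, 1[%classic : set R).
Implicit Types (u v w : R -> 'cV[R]_n) (e : 'rV[R]_n).

Definition energy e u := ip u (fun x => diag_mx e *m u x).

Lemma energy_ge0 e u : positive_row e -> 0 <= energy e u.
Proof. by move=> e0; apply: ip_ge0 => x; exact: dotv_diag_ge0. Qed.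

Lemma sqintv_diag e u : sqintv u -> sqintv (fun x => diag_mx e *m u x).
Proof. exact: sqintvM. Qed.

Lemma energyZ e (c : R) u : sqintv u ->
  energy e (fun x => c *: u x) = c ^+ 2 * energy e u.
Proof.
move=> su; rewrite /energy ipZl//; last exact/sqintv_diag/sqintvZ.
rewrite (_ : (fun x => diag_mx e *m _) = fun x => c *: (diag_mx e *m u x)).
  by rewrite ipZr//; [ring|exact: sqintvM].
by apply/funext => x; rewrite scalemxAr.
Qed.

Lemma energy_ler e e' u v (C : R) : sqintv u -> sqintv v ->
  (forall x, dotv (u x) (diag_mx e *m u x) <= C * dotv (v x) (diag_mx e' *m v x)) ->
  energy e u <= C * energy e' v.
Proof.
move=> su sv uv; have sev := sqintvM (diag_mx e') sv.
rewrite /energy -ipZl//; apply: ip_le => //; first exact: sqintvM.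
  exact: sqintvZ.
by move=> x; rewrite dotvZl.
Qed.

Lemma energyD e u v : positive_row e -> sqintv u -> sqintv v ->
  energy e (fun x => u x + v x) <= 2 * (energy e u + energy e v).
Proof.
move=> e0 su sv; have seu := sqintvM (diag_mx e) su; have sev := sqintvM (diag_mx e) sv.
have iu := integrable_dotv su seu; have iv := integrable_dotv sv sev.
rewrite /energy /ip -RintegralD// -RintegralZl//; last exact: integrable_EFinD.
apply: le_Rintegral => //.
- by apply: integrable_dotv; [exact: sqintvD|exact/sqintvM/sqintvD].
- by apply: integrable_EFinZ => //; exact: integrable_EFinD.
move=> x _; rewrite !dotv_diagsq -big_split/= mulr_sumr; apply: ler_sum => k _.
rewrite mxE -mulrDr [2 * _]mulrCA ler_wpM2l ?(ltW (e0 k))//.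
by have := sqr_ge0 (u x k 0 - v x k 0); nra.
Qed.

Lemma energyBC e u v : energy e (fun x => u x - v x) = energy e (fun x => v x - u x).
Proof.
apply: eq_Rintegral => x _; rewrite !dotv_diagsq; apply: eq_bigr => k _.
by rewrite !mxE; ring.
Qed.

Lemma ip_young e u v (c : R) : positive_row e -> 0 < c -> sqintv u -> sqintv v ->
  2 * ip u v <= c * energy (invrow e) u + c^-1 * energy e v.
Proof.
move=> e0 c0 su sv; have siu := sqintvM (diag_mx (invrow e)) su.
have sev := sqintvM (diag_mx e) sv.
rewrite /energy /ip -!RintegralZl//; [|exact: integrable_dotv..].
rewrite -RintegralD//; [|by apply: integrable_EFinZ => //; exact: integrable_dotv..].
apply: le_Rintegral => //.
- by apply: integrable_EFinZ => //; exact: integrable_dotv.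
- by apply: integrable_EFinD => //; apply: integrable_EFinZ => //; exact: integrable_dotv.
- by move=> x _; exact: young_dotv.
Qed.

Lemma ip_young_norm e u v (c : R) : positive_row e -> 0 < c -> sqintv u -> sqintv v ->
  2 * `|ip u v| <= c * energy (invrow e) u + c^-1 * energy e v.
Proof.
move=> e0 c0 su sv; have [_|_] := ger0P (ip u v); first exact: ip_young.
rewrite -mulN1r -ipZl//; apply: le_trans (ip_young e0 c0 (sqintvZ (-1) su) sv) _.
by rewrite energyZ// sqrrN expr1n mul1r.
Qed.

Lemma Rintegral_sum (f : 'I_n -> R -> R) (s : seq 'I_n) :
  (forall k, mu.-integrable U (EFin \o f k)) ->
  mu.-integrable U (EFin \o (fun x => \sum_(k <- s) f k x)) /\
  \int[mu]_(x in U) (\sum_(k <- s) f k x) = \sum_(k <- s) \int[mu]_(x in U) f k x.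
Proof.
move=> fi; elim: s => [|k s [IH1 IH2]].
  have E : (fun x => \sum_(k <- [::]) f k x) = cst 0 by apply/funext => x; rewrite big_nil.
  rewrite E; split; last by rewrite big_nil Rintegral_cst// mul0r.
  by have [_] := @sqint_cst0 R; rewrite (_ : (fun x => cst 0 x ^+ 2) = cst 0)//;
    apply/funext => x; rewrite /= expr0n.
have E : (fun x => \sum_(j <- k :: s) f j x) = fun x => f k x + \sum_(j <- s) f j x.
  by apply/funext => x; rewrite big_cons.
by rewrite E big_cons; split; [exact: integrable_EFinD|rewrite RintegralD// IH2].
Qed.

Lemma energy_dense e v (eps : R) : positive_row e -> sqintv v -> 0 < eps ->
  exists u du, [/\ C1v u du, u 0 = 0, u 1 = 0 & energy e (fun x => u x - v x) < eps].
Proof.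
move=> e0 sv eps0; pose d k := eps / (n.+1%:R * e 0 k).
have d0 k : 0 < d k by rewrite divr_gt0// mulr_gt0.
have /choice[u /choice[du uP]] := fun k => sqint_approximable (sv k) (d0 k).
exists (fun x => \col_k u k x), (fun x => \col_k du k x); split.
- by apply: C1v_col => k; have [[? ? ? _ _] _] := uP k.
- by apply/colP => k; rewrite !mxE; have [[]] := uP k.
- by apply/colP => k; rewrite !mxE; have [[]] := uP k.
have si k : sqint (u k) by have [[cu _ _ _ _] _] := uP k; exact: continuous_sqint.
have ii k : mu.-integrable U (EFin \o (fun x => (v x k 0 - u k x) ^+ 2)).
  exact: integrable_sqB (sv k) (si k).
have -> : energy e (fun x => \col_k u k x - v x) =
    \sum_k e 0 k * sqdist (fun x => v x k 0) (u k).
  have [_ IE] := Rintegral_sum (index_enum 'I_n)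
    (fun k => integrable_EFinZ (e 0 k) (@unit_measurable R) (ii k)).
  under eq_bigr do rewrite /sqdist -RintegralZl//.
  rewrite -IE.
  apply: eq_Rintegral => x _; rewrite dotv_diagsq; apply: eq_bigr => k _.
  by rewrite !mxE; ring.
apply: (@le_lt_trans _ _ (\sum_(k < n) eps / n.+1%:R)).
  apply: ler_sum => k _; have [_ /ltW] := uP k.
  move=> /(ler_wpM2l (ltW (e0 k))) /le_trans; apply.
  rewrite /d; have := e0 k; have := ltr0Sn R n; move: (n.+1%:R) (e 0 k) => N c N0 c0.
  have -> : c * (eps / (N * c)) = eps / N by field; rewrite !gt_eqF.
  exact: lexx.
rewrite sumr_const card_ord -[_ *+ n]mulr_natr mulrAC ltr_pdivrMr//.
by rewrite ltr_pM2l// ltr_nat.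
Qed.

End energies.

(** * The dual problem of a mode *)

Section dual_domain.
Context {R : realType} {n : nat} {I : finType}.
Notation mu := (@lebesgue_measure R).
Notation U := (`]0, 1[%classic : set R).
Context (Sys : switched_system R n I) (i : I) (q : 'rV[R]_n).
Hypothesis q_gt0 : positive_row q.
Hypothesis hG : lemx ((sysG Sys i)^T *m diag_mx q *m Lamp Sys i *m sysG Sys i)
  (diag_mx q *m Lamp Sys i).
Implicit Types u v du dv g : R -> 'cV[R]_n.

Local Notation lam k := (syslam Sys i 0 k).
Local Notation qi := (invrow q).

Definition dual_bc u := Lamp Sys i *m stack Sys i (u 0) (u 1) =
  (sysG Sys i)^T *m Lamp Sys i *m stack Sys i (u 1) (u 0).

Definition dual_dom u du := C1v u du /\ dual_bc u.

Lemma lam_neq0 k : lam k != 0.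
Proof.
have [km|km] := ltnP k (sysm Sys i); first by rewrite lt_eqF// syslam_lt0.
by rewrite gt_eqF// syslam_gt0.
Qed.

Lemma lam_norm_gt0 k : 0 < `|lam k|. Proof. by rewrite normr_gt0 lam_neq0. Qed.

Lemma LampE (v : 'cV[R]_n) k : (Lamp Sys i *m v) k 0 = `|lam k| * v k 0.
Proof. by rewrite diag_mulE mxE. Qed.

Lemma stackZ (c : R) (a b : 'cV[R]_n) :
  stack Sys i (c *: a) (c *: b) = c *: stack Sys i a b.
Proof. by apply/colP => k; rewrite !mxE; case: ifP. Qed.

Lemma stackD (a b a' b' : 'cV[R]_n) :
  stack Sys i (a + a') (b + b') = stack Sys i a b + stack Sys i a' b'.
Proof. by apply/colP => k; rewrite !mxE; case: ifP. Qed.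

Lemma dual_dom_scale (c : R) u du : dual_dom u du ->
  dual_dom (fun x => c *: u x) (fun x => c *: du x).
Proof.
move=> [uC bcu]; split; first exact: C1v_scale.
by rewrite /dual_bc !stackZ -!scalemxAr bcu.
Qed.

Lemma dual_dom_add u v du dv : dual_dom u du -> dual_dom v dv ->
  dual_dom (fun x => u x + v x) (fun x => du x + dv x).
Proof.
move=> [uC bcu] [vC bcv]; split; first exact: C1v_add.
by rewrite /dual_bc !stackD !mulmxDr bcu bcv.
Qed.

Lemma dual_boundary_contraction (p s : 'cV[R]_n) :
  Lamp Sys i *m p = (sysG Sys i)^T *m Lamp Sys i *m s ->
  \sum_k `|lam k| / q 0 k * p k 0 ^+ 2 <= \sum_k `|lam k| / q 0 k * s k 0 ^+ 2.
Proof.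
move=> ps; pose w : 'rV[R]_n := \row_k (q 0 k * `|lam k|).
have w0 : positive_row w by move=> k; rewrite mxE mulr_gt0// lam_norm_gt0.
have wE : diag_mx q *m Lamp Sys i = diag_mx w.
  by rewrite mulmx_diag; congr diag_mx; apply/rowP => k; rewrite !mxE.
have contr (v : 'cV[R]_n) : dotv (sysG Sys i *m v) (diag_mx w *m (sysG Sys i *m v)) <=
    dotv v (diag_mx w *m v).
  have := lemx_dotv v hG; rewrite wE -!mulmxA [diag_mx q *m _]mulmxA wE.
  by rewrite [in X in X -> _]dotvC dotvM trmxK dotvC.
have := dual_contraction w0 contr (Lamp Sys i *m s).
rewrite mulmxA -ps !dotv_diagsq.
have E (v : 'cV[R]_n) : \sum_k invrow w 0 k * (Lamp Sys i *m v) k 0 ^+ 2 =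
    \sum_k `|lam k| / q 0 k * v k 0 ^+ 2.
  apply: eq_bigr => k _; rewrite LampE !mxE; field.
  by rewrite !gt_eqF// lam_norm_gt0.
by rewrite !E.
Qed.

Lemma dual_boundary_flux u : dual_bc u ->
  \sum_k lam k / q 0 k * (u 1 k 0 ^+ 2 - u 0 k 0 ^+ 2) <= 0.
Proof.
move=> /dual_boundary_contraction; rewrite -subr_le0 -sumrB.
congr (_ <= _); apply: eq_bigr => k _; rewrite !mxE.
have [km|km] := ltnP k (sysm Sys i).
  by rewrite ltr0_norm ?syslam_lt0//; ring.
by rewrite gtr0_norm ?syslam_gt0//; ring.
Qed.

Lemma LamE (v : 'cV[R]_n) k : (Lam Sys i *m v) k 0 = lam k * v k 0.
Proof. by rewrite diag_mulE. Qed.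

Lemma dual_flux u du : dual_dom u du ->
  ip u (fun x => diag_mx qi *m (Lam Sys i *m du x)) <= 0.
Proof.
move=> [[cu cdu du_] bcu].
pose F (x : R) := \sum_k 2^-1 * (lam k / q 0 k) * (u x k 0 * u x k 0).
have -> : ip u (fun x => diag_mx qi *m (Lam Sys i *m du x)) = F 1 - F 0; last first.
  rewrite -sumrB -(pmulr_rle0 _ (ltr0n _ 2)) mulr_sumr.
  apply: le_trans (dual_boundary_flux bcu).
  by rewrite le_eqVlt; apply/orP; left; apply/eqP; apply: eq_bigr => k _; field;
    rewrite gt_eqF.
apply: unit_FTC2.
- rewrite (_ : (fun x => _) = fun x => \sum_k qi 0 k * (u x k 0 * (lam k * du x k 0))).
    apply: contv_sum => k x; apply: cvgM; first exact: cvg_cst.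
    apply: cvgM; first exact: cu.
    by apply: cvgM; [exact: cvg_cst|exact: cdu].
  by apply/funext => x; rewrite dotv_diag; under eq_bigr do rewrite LamE.
- apply: contv_sum => k x; apply: cvgM; first exact: cvg_cst.
  by apply: cvgM; exact: cu.
move=> x x01.
have -> : dotv (u x) (diag_mx qi *m (Lam Sys i *m du x)) =
   \sum_k 2^-1 * (lam k / q 0 k) * (du x k 0 * u x k 0 + u x k 0 * du x k 0).
  rewrite dotv_diag; apply: eq_bigr => k _; rewrite LamE mxE; field.
  by rewrite gt_eqF.
apply: (@is_derive_sumv R n _ (fun k x => 2^-1 * (lam k / q 0 k) *
  (du x k 0 * u x k 0 + u x k 0 * du x k 0))) => k.
by apply: is_derive_scale; apply: is_derive_mul; exact: du_.
Qed.

Lemma resolvent_contraction (h : R) u du g : 0 <= h -> dual_dom u du -> sqintv g ->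
  (forall x, u x - h *: (Lam Sys i *m du x) = g x) ->
  energy qi u <= energy qi g.
Proof.
move=> h0 uD sg ug; have [[cu cdu _] _] := uD.
have su := contv_sqintv cu; have sdu := contv_sqintv cdu.
set v := fun x => diag_mx qi *m (Lam Sys i *m du x).
have sv : sqintv v by do 2 apply: sqintvM.
have uv : ip u v <= 0 by exact: dual_flux.
apply: (@le_trans _ _ (energy qi u - 2 * h * ip u v)).
  by rewrite lerDl oppr_ge0 mulr_ge0_le0 ?mulr_ge0.
rewrite -ipZr// -ipBr//; last 2 first.
- exact: sqintvM.
- exact: sqintvZ.
apply: ip_le => //.
- by apply: sqintvB; [exact: sqintvM|exact: sqintvZ].
- exact: sqintvM.
move=> x; rewrite -ug /v !(dotvC (u x)).
rewrite -subr_ge0; set D := (X in 0 <= X).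
have -> : D = dotv (h *: (Lam Sys i *m du x)) (diag_mx qi *m (h *: (Lam Sys i *m du x))).
  rewrite /D; move: (u x) (Lam Sys i *m du x) => a b.
  rewrite !dotvE -!sumrB; apply: eq_bigr => k _.
  have colD (y z : 'cV[R]_n) : (y - z) k 0 = y k 0 - z k 0 by rewrite !mxE.
  have colZ c (y : 'cV[R]_n) : (c *: y) k 0 = c * y k 0 by rewrite mxE.
  by rewrite !(colD, diag_mulE, colZ); ring.
exact/dotv_diag_ge0/invrow_positive.
Qed.

End dual_domain.

Section resolvent.
Context {R : realType}.
Implicit Types g u : R -> R.

(* [p] is the value at the end where the backward transport of speed [l] enters
   the interval, [expR _ * p + r] the value at the end where it leaves. *)
Lemma scalar_resolvent (h l : R) g : 0 < h -> l != 0 -> continuous g ->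
  exists r, forall p, exists u du : R -> R,
    [/\ continuous u, continuous du,
        forall x : R, 0 < x < 1 -> is_derive x 1 u (du x),
        forall x, u x - h * (l * du x) = g x
      & if 0 < l then u 1 = p /\ u 0 = expR (- (h * `|l|)^-1) * p + r
        else u 0 = p /\ u 1 = expR (- (h * `|l|)^-1) * p + r].
Proof.
move=> h0 l0 cg; pose K := (h * l)^-1.
have hl0 : h * l != 0 by rewrite mulf_neq0// gt_eqF.
have dexp (c x : R) : is_derive x 1 (fun y => expR (c * y)) (c * expR (c * x)).
  have dc : is_derive x 1 (fun y : R => c * y) (c * 1) by exact: is_derive_scale.
  have := is_derive1_comp (is_derive_expR (c * x)) dc.
  by rewrite mulr1 mulrC.
have cexp (c : R) : continuous (fun y => expR (c * y)).
  by move=> x; exact: is_derive_continuous (dexp c x).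
have [P cP dP] : exists2 P : R -> R, continuous P & forall x : R, 0 < x ->
    is_derive x 1 P (K * expR (- K * x) * g x).
  apply: primitive => x; apply: cvgM; last exact: cg.
  by apply: cvgM; [exact: cvg_cst|exact: cexp].
pose u (c x : R) := expR (K * x) * (c - P x).
pose du c x := K * (u c x - g x).
have cu c : continuous (u c).
  move=> x; apply: cvgM; first exact: cexp.
  by apply: cvgB; [exact: cvg_cst|exact: cP].
have cdu c : continuous (du c).
  move=> x; apply: cvgM; first exact: cvg_cst.
  by apply: cvgB; [exact: cu|exact: cg].
have duE (c x : R) : 0 < x < 1 -> is_derive x 1 (u c) (du c x).
  move=> /andP[x0 _].
  have := is_derive_mul (dexp K x) (is_derive_sub (is_derive_cst c x 1) (dP _ x0)).
  congr is_derive; rewrite /du /u mulNr expRN.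
  rewrite /=; clearbody K; move: (expR (K * x)) (expR_gt0 (K * x)) => E E0.
  by field; rewrite gt_eqF.
have eqn c x : u c x - h * (l * du c x) = g x.
  by rewrite /du /K; field; rewrite l0 gt_eqF.
have [l_gt0|l_lt0|l00] := ltgtP 0 l; last by rewrite -l00 eqxx in l0.
  have KE : - (h * `|l|)^-1 = - K by rewrite gtr0_norm.
  exists (P 1 - P 0) => p; exists (u (expR (- K) * p + P 1)), (du (expR (- K) * p + P 1)).
  split; [exact: cu|exact: cdu|exact: duE|exact: eqn|rewrite KE /u].
  rewrite mulr1 mulr0 expR0 mul1r addrK mulrA -expRD subrr expR0 mul1r.
  by rewrite addrA.
have KE : - (h * `|l|)^-1 = K by rewrite ltr0_norm// mulrN invrN opprK.
exists (expR K * (P 0 - P 1)) => p; exists (u (p + P 0)), (du (p + P 0)).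
split; [exact: cu|exact: cdu|exact: duE|exact: eqn|rewrite KE /u].
by rewrite mulr1 mulr0 expR0 mul1r addrK -addrA mulrDr.
Qed.

Context {n : nat} {I : finType}.
Context (Sys : switched_system R n I) (i : I) (q : 'rV[R]_n).
Hypothesis q_gt0 : positive_row q.
Hypothesis hG : lemx ((sysG Sys i)^T *m diag_mx q *m Lamp Sys i *m sysG Sys i)
  (diag_mx q *m Lamp Sys i).
Local Notation lam k := (syslam Sys i 0 k).

Lemma boundary_unitmx (e : 'rV[R]_n) : (forall k, 0 <= e 0 k < 1) ->
  Lamp Sys i - (sysG Sys i)^T *m Lamp Sys i *m diag_mx e \in unitmx.
Proof.
move=> e01; apply: injective_unitmx => p; rewrite mulmxBl => /subr0_eq.
rewrite -[X in _ = X]mulmxA => /(dual_boundary_contraction q_gt0 hG).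
have c0 k : 0 < `|lam k| / q 0 k by rewrite divr_gt0// lam_norm_gt0.
rewrite -subr_ge0 -sumrB => sum_ge0.
pose t k := `|lam k| / q 0 k * (1 - e 0 k ^+ 2) * p k 0 ^+ 2.
have e2 k : 0 < 1 - e 0 k ^+ 2.
  by have /andP[e0 e1] := e01 k; rewrite subr_gt0 expr_lt1.
have t0 k : 0 <= t k by rewrite mulr_ge0 ?sqr_ge0// mulr_ge0// ltW.
have : \sum_k t k <= 0.
  rewrite -oppr_ge0 -sumrN; apply: le_trans sum_ge0 _.
  by apply: ler_sum => k _; rewrite diag_mulE /t le_eqVlt; apply/orP; left; apply/eqP; ring.
move=> tle; have /eqP : \sum_k t k = 0 by apply/eqP; rewrite eq_le tle sumr_ge0.
rewrite psumr_eq0// => /allP /= tk0.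
apply/colP => k; have := tk0 k; rewrite mem_index_enum => /(_ isT)/eqP/eqP.
by rewrite mulf_eq0 mulf_eq0 (gt_eqF (c0 k)) (gt_eqF (e2 k))/= sqrf_eq0 mxE => /eqP.
Qed.

Lemma dual_resolvent (h : R) (g : R -> 'cV[R]_n) : 0 < h -> contv g ->
  exists u du : R -> 'cV[R]_n, dual_dom Sys i u du /\
    forall x, u x - h *: (Lam Sys i *m du x) = g x.
Proof.
move=> h0 cg.
have /choice[r rP] := fun k => scalar_resolvent h0 (lam_neq0 Sys i k) (cg k).
pose e : 'rV[R]_n := \row_k expR (- (h * `|lam k|)^-1).
have e01 k : 0 <= e 0 k < 1.
  by rewrite mxE expR_ge0/= -expR0 ltr_expR oppr_lt0 invr_gt0 mulr_gt0// lam_norm_gt0.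
pose M := Lamp Sys i - (sysG Sys i)^T *m Lamp Sys i *m diag_mx e.
pose p := invmx M *m ((sysG Sys i)^T *m Lamp Sys i *m (\col_k r k)).
have pE : Lamp Sys i *m p =
    (sysG Sys i)^T *m Lamp Sys i *m (diag_mx e *m p + \col_k r k).
  have : M *m p = (sysG Sys i)^T *m Lamp Sys i *m (\col_k r k).
    by rewrite /p mulmxA mulmxV ?mul1mx// boundary_unitmx.
  by rewrite mulmxDr => <-; rewrite /M mulmxBl -[X in _ - X]mulmxA addrC subrK.
have /choice[u /choice[du uP]] := fun k => rP k (p k 0).
exists (fun x => \col_k u k x), (fun x => \col_k du k x); split; last first.
  move=> x; apply/colP => k; have [_ _ _ <- _] := uP k.
  rewrite mxE [X in _ + X]mxE [X in - X]mxE LamE !mxE//.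
split.
  by apply: C1v_col => k; have [? ? ? _ _] := uP k.
rewrite /dual_bc; set a := stack _ _ _ _; set b := stack _ _ _ _.
have -> : a = p.
  apply/colP => k; rewrite mxE; have [_ _ _ _] := uP k.
  have [km|km] := ltnP k (sysm Sys i); rewrite !mxE.
    by rewrite ltNge ltW ?syslam_lt0//= => -[].
  by rewrite syslam_gt0// => -[].
suff -> : b = diag_mx e *m p + \col_k r k by [].
apply/colP => k; rewrite mxE [in RHS]mxE diag_mulE; have [_ _ _ _] := uP k.
have [km|km] := ltnP k (sysm Sys i); rewrite !mxE.
  by rewrite ltNge ltW ?syslam_lt0//= => -[].
by rewrite syslam_gt0// => -[].
Qed.

End resolvent.

(** * Energy decay in a mode *)

Section mode_decay.
Context {R : realType} {n : nat} {I : finType}.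
Notation mu := (@lebesgue_measure R).
Notation U := (`]0, 1[%classic : set R).
Context (Sys : switched_system R n I) (i : I) (q : 'rV[R]_n) (nu : R).
Hypothesis q_gt0 : positive_row q.
Hypothesis nu_gt0 : 0 < nu.
Hypothesis hF : lemx ((sysF Sys i)^T *m diag_mx q + diag_mx q *m sysF Sys i)
  (- (2 * nu) *: diag_mx q).
Hypothesis hG : lemx ((sysG Sys i)^T *m diag_mx q *m Lamp Sys i *m sysG Sys i)
  (diag_mx q *m Lamp Sys i).
Implicit Types u v du dv g : R -> 'cV[R]_n.
Local Notation F := (sysF Sys i).
Local Notation qi := (invrow q).
Local Notation Es := (energy qi).

Lemma qi_gt0 : positive_row qi. Proof. exact: invrow_positive. Qed.

Lemma invrow_invrow : invrow qi = q.
Proof. by apply/rowP => k; rewrite !mxE invrK. Qed.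

Lemma dual_dissipative (a : 'cV[R]_n) :
  dotv a (diag_mx qi *m (F^T *m a)) <= - nu * dotv a (diag_mx qi *m a).
Proof.
set v := diag_mx qi *m a; have aE : diag_mx q *m v = a by exact: invrowK.
have lhsE : dotv v ((F^T *m diag_mx q + diag_mx q *m F) *m v) = 2 * dotv (F^T *m a) v.
  rewrite mulmxDl -[_ *m F *m v]mulmxA -[F^T *m _ *m v]mulmxA aE dotvC dotvDl.
  rewrite mulr_natl mulr2n; congr (_ + _).
  by rewrite dotvC dotv_diagC aE dotvM dotvC.
have rhsE : dotv v ((- (2 * nu) *: diag_mx q) *m v) = - (2 * nu) * dotv a v.
  by rewrite -scalemxAl aE dotvC dotvZl.
have := lemx_dotv v hF; rewrite lhsE rhsE dotv_diagC -/v => ?.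
by lra.
Qed.

Lemma explicit_step : exists2 C, 0 < C &
  (forall g, sqintv g -> Es (fun x => F^T *m g x) <= C * Es g) /\
  forall h g, 0 < h -> h * C <= nu -> sqintv g ->
    Es (fun x => g x + h *: (F^T *m g x)) <= (1 - nu * h) * Es g.
Proof.
have [C C0 CP] := form_bounded (F *m diag_mx qi *m F^T) qi_gt0.
have {}CP a : dotv (F^T *m a) (diag_mx qi *m (F^T *m a)) <= C * dotv a (diag_mx qi *m a).
  by rewrite dotvM trmxK [diag_mx qi *m _]mulmxA [F *m (_ *m _)]mulmxA [F *m (_ *m _)]mulmxA.
exists C => //; split=> [g sg|h g h0 hC sg].
  by apply: energy_ler => //; exact: sqintvM.
apply: energy_ler => // [|x]; first by apply: sqintvD => //; apply/sqintvZ/sqintvM.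
have := CP (g x); have := dual_dissipative (g x).
have := dotv_diag_ge0 (g x) qi_gt0; move: (F^T *m g x) => b.
have -> : dotv (g x + h *: b) (diag_mx qi *m (g x + h *: b)) =
    dotv (g x) (diag_mx qi *m g x) + 2 * h * dotv (g x) (diag_mx qi *m b) +
    h ^+ 2 * dotv b (diag_mx qi *m b).
  rewrite !dotv_diag !mulr_sumr -!big_split/=; apply: eq_bigr => k _.
  by rewrite !mxE; ring.
set A := dotv (g x) _; set B := dotv (g x) _; set D := dotv b _ => A0 BA DA.
have : h ^+ 2 * D <= h ^+ 2 * (C * A) by rewrite ler_wpM2l ?sqr_ge0.
have : h * B <= h * (- nu * A) by rewrite ler_wpM2l// ltW.
have : h * (h * C) * A <= h * nu * A by rewrite ler_wpM2r// ler_wpM2l// ltW.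
by move=> *; nra.
Qed.

Context (a T : R) (y : R -> R -> 'cV[R]_n).
Hypothesis aT : a < T.
Hypothesis sy : forall t, a <= t <= T -> sqintv (y t).
Hypothesis cy : forall t, a <= t <= T -> forall e, 0 < e ->
  \forall s \near t, a <= s <= T -> energy q (fun x => y s x - y t x) < e.
Hypothesis wy : forall T', a < T' <= T -> weak_mode_sol Sys i a T' y.

Lemma uniformly_continuous_energy e : 0 < e -> exists2 d, 0 < d &
  forall s t, a <= s <= T -> a <= t <= T -> `|s - t| < d ->
    energy q (fun x => y s x - y t x) < e.
Proof.
move=> e0.
pose P d t := a <= t <= T -> forall s, a <= s <= T -> `|s - t| < d ->
    energy q (fun x => y s x - y t x) < e.
have := (compact_near_coveringP `[a, T]).1 (@segment_compact R a T) R 0^'+ P _.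
case=> [t /=|d' d'0 Pd'].
  rewrite in_itv/= => taT.
  have e40 : 0 < e / 4 by rewrite divr_gt0.
  have /nbhs_ballP[r /= r0 rP] := cy taT e40.
  have r20 : 0 < r / 2 by rewrite divr_gt0.
  exists (ball t (r / 2), [set d | d < r / 2]) => /=.
    by split; [exact: nbhsx_ballx|exact: nbhs_right_lt].
  move=> [t' d] /= [tt' dr] t'aT s saT st'.
  rewrite /ball/= in tt'.
  have y1 := rP s _ saT; have y2 := rP t' _ t'aT.
  have {}y1 : energy q (fun x => y s x - y t x) < e / 4.
    apply: y1; rewrite /ball/= distrC.
    have -> : s - t = (s - t') + (t' - t) by ring.
    rewrite (le_lt_trans (ler_normD _ _))// (distrC t') [r]splitr ltrD//.
    exact: lt_trans dr.
  have {}y2 : energy q (fun x => y t x - y t' x) < e / 4.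
    rewrite energyBC; apply: y2; rewrite /ball/= (lt_trans tt')//.
    by rewrite ltr_pdivrMr// ltr_pMr// ltr1n.
  have -> : (fun x => y s x - y t' x) = (fun x => (y s x - y t x) + (y t x - y t' x)).
    by apply/funext => x; rewrite addrA subrK.
  apply: le_lt_trans (energyD q_gt0 _ _) _; [by apply: sqintvB; exact: sy..|].
  by move: y1 y2; lra.
exists (d' / 2); first by rewrite divr_gt0.
move=> s t saT taT std; apply: (Pd' (d' / 2)) => //=.
- by rewrite sub0r normrN gtr0_norm ?divr_gt0// ltr_pdivrMr// ltr_pMr// ltr1n.
- by rewrite divr_gt0.
Qed.

Lemma bounded_energy : exists2 M, 0 <= M & forall t, a <= t <= T -> energy q (y t) <= M.
Proof.
pose P M t := a <= t <= T -> energy q (y t) <= M.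
have := (compact_near_coveringP `[a, T]).1 (@segment_compact R a T) R +oo P _.
case=> [t /=|M [_ MP]].
  rewrite in_itv/= => taT.
  have /nbhs_ballP[r /= r0 rP] := cy taT ltr01.
  exists (ball t r, [set M | 2 * (1 + energy q (y t)) <= M]) => /=.
    by split; [exact: nbhsx_ballx|by apply: nbhs_pinfty_ge; rewrite num_real].
  move=> [s M] /= [ts hM] saT; apply: le_trans hM.
  have -> : y s = fun x => (y s x - y t x) + y t x.
    by apply/funext => x; rewrite subrK.
  apply: le_trans (energyD q_gt0 _ _) _; [by apply: sqintvB; exact: sy|exact: sy|].
  by rewrite ler_wpM2l// lerD2r ltW// rP.
exists (`|M| + 1) => [|t taT]; first by rewrite addr_ge0.
apply: (MP (`|M| + 1)) => //.
by rewrite (le_lt_trans (ler_norm _))// ltrDl.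
Qed.

Lemma continuous_pairing v : sqintv v -> {within `[a, T], continuous (fun t => ip v (y t))}.
Proof.
move=> sv; apply/subspace_continuousP => t; rewrite /= in_itv/= => taT.
apply/cvgrPdist_lt => e e0; rewrite near_withinE.
have v1 : 0 < Es v + 1 by rewrite ltr_wpDl// energy_ge0//; exact: qi_gt0.
pose c := e / (Es v + 1); have c0 : 0 < c by rewrite divr_gt0.
have ce0 : 0 < c * e by rewrite mulr_gt0.
have := cy taT ce0; apply: filterS => s + saT => /(_ saT) ys.
rewrite -ipBr//; [|exact: sy..].
have := ip_young_norm q_gt0 c0 sv (sqintvB (sy taT) (sy saT)).
rewrite [energy q _]energyBC => le1.
have le2 : c^-1 * energy q (fun x => y s x - y t x) < e.
  by rewrite mulrC ltr_pdivrMr// mulrC.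
have le3 : c * Es v <= e.
  by rewrite /c mulrAC ler_pdivrMr// ler_wpM2l ?lerDl// ltW.
by move: le1 le2 le3; lra.
Qed.

End mode_decay.

Section euler.
Context {R : realType} {n : nat} {I : finType}.
Notation mu := (@lebesgue_measure R).
Notation U := (`]0, 1[%classic : set R).
Context (Sys : switched_system R n I) (i : I) (q : 'rV[R]_n) (nu : R).
Hypothesis q_gt0 : positive_row q.
Hypothesis nu_gt0 : 0 < nu.
Hypothesis hF : lemx ((sysF Sys i)^T *m diag_mx q + diag_mx q *m sysF Sys i)
  (- (2 * nu) *: diag_mx q).
Hypothesis hG : lemx ((sysG Sys i)^T *m diag_mx q *m Lamp Sys i *m sysG Sys i)
  (diag_mx q *m Lamp Sys i).
Context (a T : R) (y : R -> R -> 'cV[R]_n).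
Hypothesis aT : a < T.
Hypothesis sy : forall t, a <= t <= T -> sqintv (y t).
Hypothesis cy : forall t, a <= t <= T -> forall e, 0 < e ->
  \forall s \near t, a <= s <= T -> energy q (fun x => y s x - y t x) < e.
Hypothesis wy : forall T', a < T' <= T -> weak_mode_sol Sys i a T' y.
Implicit Types u v du dv g psi chi : R -> 'cV[R]_n.
Local Notation F := (sysF Sys i).
Local Notation Lam := (Lam Sys i).
Local Notation qi := (invrow q).
Local Notation Es := (energy qi).

Let qi0 : positive_row qi. Proof. exact: invrow_positive. Qed.

Lemma dual_dom_sqintv u du : dual_dom Sys i u du -> sqintv u /\ sqintv du.
Proof. by move=> [[cu cdu _] _]; split; exact: contv_sqintv. Qed.

Lemma C1_rect_static (b : R) u du : C1v u du ->
  C1_rect a b (fun=> u) (fun _ _ => 0) (fun=> du).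
Proof.
move=> [cu cdu du_]; split=> [k f fE|k t x _ _|k t x _ x01]; last exact: du_.
  apply: continuous_subspaceT => p.
  have csnd (g : R -> 'cV[R]_n) : contv g -> {for p, continuous (fun p : R * R => g p.2 k 0)}.
    move=> cg; apply: (@continuous_comp _ _ _ (fun p : R * R => p.2) (fun x => g x k 0)).
      exact: cvg_snd.
    exact: cg.
  case: fE => [->|[->|->]]; [exact: csnd| |exact: csnd].
  exact: cvg_cst.
by rewrite mxE; exact: is_derive_cst.
Qed.

Lemma pairing_increment u du (t t' : R) : dual_dom Sys i u du ->
  a <= t -> t < t' -> t' <= T ->
  ip u (y t') - ip u (y t) =
  \int[mu]_(s in `]t, t']) ip (fun x => Lam *m du x + F^T *m u x) (y s).
Proof.
move=> [uC ubc] at_ tt' t'T; pose g x := Lam *m du x + F^T *m u x.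
have incr b : a < b -> b <= T ->
    ip u (y b) - ip u (y a) = \int[mu]_(s in `[a, b]) ip g (y s).
  move=> ab bT; have abT : a < b <= T by rewrite ab.
  have := wy abT (C1_rect_static b uC) (fun _ _ => ubc).
  rewrite /ip => ->; apply: eq_Rintegral => s _; apply: eq_Rintegral => x _.
  by rewrite add0r.
have at' : a < t' by exact: le_lt_trans tt'.
have sg : sqintv g.
  have [cu cdu _] := uC.
  by apply: sqintvD; apply: sqintvM; exact: contv_sqintv.
have int_g : mu.-integrable `[a, t'] (EFin \o (fun s => ip g (y s))).
  apply: continuous_compact_integrable; first exact: segment_compact.
  apply: continuous_subspaceW (continuous_pairing q_gt0 sy cy sg).
  by apply: subset_itvl; rewrite bnd_simp.
rewrite -(Rintegral_itvB int_g) ?bnd_simp//; last exact: ltW.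
rewrite -incr//; have [at1|] := ltP a t.
  rewrite -incr ?(le_trans (ltW tt'))//; ring.
rewrite le_eqVlt ltNge at_ orbF => /eqP ->.
by rewrite set_itv1 Rintegral_set1 subr0.
Qed.

Context (C M : R).
Hypothesis C_ge0 : 0 <= C.
Hypothesis FC : forall g, sqintv g -> Es (fun x => F^T *m g x) <= C * Es g.
Hypothesis yM : forall t, a <= t <= T -> energy q (y t) <= M.

Lemma euler_step psi dpsi chi dchi (h t eta omega B : R) :
  dual_dom Sys i psi dpsi -> dual_dom Sys i chi dchi ->
  (forall x, chi x - h *: (Lam *m dchi x) = psi x + h *: (F^T *m psi x)) ->
  0 < h -> a <= t -> t + h <= T -> 0 < eta ->
  (forall s, t <= s <= t + h -> energy q (fun x => y s x - y (t + h) x) <= omega) ->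
  Es (fun x => h^-1 *: (chi x - psi x)) <= B ->
  2 * (ip psi (y (t + h)) - ip chi (y t)) <=
    h * (eta * B + omega / eta + h * (C * B + M)).
Proof.
move=> psiD chiD eqn h0 at_ thT eta0 yom; set D := Es _ => DB.
have [spsi sdpsi] := dual_dom_sqintv psiD; have [schi sdchi] := dual_dom_sqintv chiD.
pose d x := h^-1 *: (chi x - psi x).
have sd : sqintv d by apply/sqintvZ/sqintvB.
have sFd : sqintv (fun x => F^T *m d x) by exact: sqintvM.
have th : t < t + h by rewrite ltrDl.
have thT' : a <= t + h <= T by rewrite thT (le_trans at_)// ltW.
have syT := sy thT'.
have AchiE : (fun x => Lam *m dchi x + F^T *m chi x) = (fun x => d x + h *: (F^T *m d x)).
  apply/funext => x; apply: (scalerI (lt0r_neq0 h0)).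
  have chiE : chi x = psi x + h *: d x by rewrite /d scalerA mulfV ?gt_eqF// scale1r addrC subrK.
  have Lchi : h *: (Lam *m dchi x) = h *: d x - h *: (F^T *m psi x).
    apply/eqP; rewrite eq_sym subr_eq -(inj_eq (addrI (psi x))) -chiE.
    by rewrite addrCA -eqn addrC subrK.
  rewrite scalerDr Lchi chiE mulmxDr !scalerDr -scalemxAr.
  by rewrite addrA subrK.
have incr := pairing_increment chiD at_ th thT; rewrite AchiE in incr.
have sA : sqintv (fun x => d x + h *: (F^T *m d x)) by apply/sqintvD/sqintvZ.
set W := eta * B + omega / eta + h * (C * B + M).
have bnd s : t <= s <= t + h ->
    2 * ip (fun x => d x + h *: (F^T *m d x)) (y s) <= 2 * ip d (y (t + h)) + W.
  move=> sth; have saT : a <= s <= T.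
    by case/andP: sth => ts sth; rewrite (le_trans at_ ts) (le_trans sth thT).
  have sys := sy saT.
  rewrite ipDl//; last exact: sqintvZ.
  rewrite ipZl//.
  have := ip_young q_gt0 eta0 sd (sqintvB sys syT); rewrite ipBr//.
  have := ip_young q_gt0 ltr01 sFd sys; rewrite invr1 !mul1r => y1 y2.
  have y3 : eta^-1 * energy q (fun x => y s x - y (t + h) x) <= omega / eta.
    by rewrite mulrC ler_wpM2r ?yom// invr_ge0 ltW.
  have y4 : h * (2 * ip (fun x => F^T *m d x) (y s)) <= h * (C * B + M).
    rewrite ler_wpM2l ?(ltW h0)// (le_trans y1)// lerD ?yM//.
    by rewrite (le_trans (FC sd))// ler_wpM2l.
  have y5 : eta * D <= eta * B by rewrite ler_wpM2l// ltW.
  by rewrite /W; move: y2 y3 y4 y5; rewrite -/D; lra.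
have int_A : mu.-integrable `]t, t + h]
    (EFin \o (fun s => ip (fun x => d x + h *: (F^T *m d x)) (y s))).
  apply: (@integrableS _ _ _ mu `[a, T]) => //.
    by apply: subset_itv; rewrite bnd_simp.
  apply: continuous_compact_integrable; first exact: segment_compact.
  exact: continuous_pairing.
have muth : fine (mu `]t, t + h]) = h.
  by rewrite lebesgue_measure_itv/= lte_fin th/= addrC addKr.
have main : 2 * (ip chi (y (t + h)) - ip chi (y t)) <= h * (2 * ip d (y (t + h)) + W).
  have -> : h * (2 * ip d (y (t + h)) + W) =
      \int[mu]_(_ in `]t, t + h]) (2 * ip d (y (t + h)) + W).
    by rewrite Rintegral_cst// muth mulrC.
  rewrite incr -RintegralZl//.
  apply: le_Rintegral => //.
  - exact: integrable_EFinZ.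
  - apply: (@integrableS _ _ _ mu `[a, T]) => //.
      by apply: subset_itv; rewrite bnd_simp.
    apply: continuous_compact_integrable; first exact: segment_compact.
    by apply: continuous_subspaceT => x; exact: cvg_cst.
  - move=> s /=; rewrite in_itv/= => /andP[ts sth]; apply: bnd.
    by rewrite (ltW ts).
have dE : h * ip d (y (t + h)) = ip chi (y (t + h)) - ip psi (y (t + h)).
  by rewrite -ipBl// -ipZl//; congr ip; apply/funext => x;
    rewrite /d scalerA mulfV ?gt_eqF// scale1r.
by move: main; rewrite [leRHS]mulrDr [h * (2 * _)]mulrCA dE; lra.
Qed.

Hypothesis nuh : forall h g, 0 < h -> h * C <= nu -> sqintv g ->
  Es (fun x => g x + h *: (F^T *m g x)) <= (1 - nu * h) * Es g.

(* Backward Euler iterates of the dual problem; [B] bounds all discrete time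
   derivatives of the iterates, since they solve the same recursion. *)
Lemma euler_iterate (h eta omega B : R) N psi dpsi chi dchi :
  dual_dom Sys i psi dpsi -> dual_dom Sys i chi dchi ->
  (forall x, chi x - h *: (Lam *m dchi x) = psi x + h *: (F^T *m psi x)) ->
  Es (fun x => h^-1 *: (chi x - psi x)) <= B ->
  0 < h -> h * C <= nu -> nu * h <= 1 -> a + N%:R * h <= T -> 0 < eta ->
  (forall s t, a <= s <= T -> a <= t <= T -> `|s - t| <= h ->
    energy q (fun x => y s x - y t x) <= omega) ->
  exists phi, [/\ sqintv phi, Es phi <= (1 - nu * h) ^+ N * Es psi &
    2 * ip psi (y (a + N%:R * h)) <= 2 * ip phi (y a) +
      N%:R * (h * (eta * B + omega / eta + h * (C * B + M)))].
Proof.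
move=> + + + + h0 hC nuh1 + eta0 om.
elim: N psi dpsi chi dchi => [|N IH] psi dpsi chi dchi psiD chiD eqn DB NT.
  have [spsi _] := dual_dom_sqintv psiD.
  exists psi; split; [exact: spsi|by rewrite expr0 mul1r|by rewrite !mul0r !addr0].
have [spsi sdpsi] := dual_dom_sqintv psiD; have [schi sdchi] := dual_dom_sqintv chiD.
set d := fun x => h^-1 *: (chi x - psi x) in DB.
have dD : dual_dom Sys i d (fun x => h^-1 *: (dchi x + (-1) *: dpsi x)).
  have := dual_dom_scale h^-1 (dual_dom_add chiD (dual_dom_scale (-1) psiD)).
  rewrite (_ : (fun x => h^-1 *: (chi x + -1 *: psi x)) = d)//.
  by apply/funext => x; rewrite scaleN1r.
have [[cchi _ _] _] := chiD.
have cg : contv (fun x => chi x + h *: (F^T *m chi x)) by apply/contvD/contvZ/contvM.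
have [chi2 [dchi2 [chi2D eqn2]]] := dual_resolvent q_gt0 hG h0 cg.
have [schi2 sdchi2] := dual_dom_sqintv chi2D.
have [sd _] := dual_dom_sqintv dD.
have contraction : 1 - nu * h <= 1 by rewrite gerBl mulr_ge0// ltW.
have D2B : Es (fun x => h^-1 *: (chi2 x - chi x)) <= B.
  have d2D := dual_dom_scale h^-1 (dual_dom_add chi2D (dual_dom_scale (-1) chiD)).
  have sgd : sqintv (fun x => d x + h *: (F^T *m d x)) by apply/sqintvD/sqintvZ/sqintvM.
  have d2E : (fun x => h^-1 *: (chi2 x + -1 *: chi x)) = (fun x => h^-1 *: (chi2 x - chi x)).
    by apply/funext => x; rewrite scaleN1r.
  rewrite d2E in d2D.
  apply: le_trans (resolvent_contraction q_gt0 hG (ltW h0) d2D sgd _) _.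
    move=> x; rewrite /d -!scalemxAr scaleN1r !mulmxBr.
    have /eqP := eqn2 x; have /eqP := eqn x; rewrite !subr_eq.
    move: (F^T *m chi x) (F^T *m psi x) (Lam *m dchi x) (Lam *m dchi2 x) => X Y Z Z2.
    move=> /eqP chiE /eqP ->; rewrite chiE.
    by apply/colP => k; rewrite !mxE; field; rewrite gt_eqF.
  apply: le_trans (nuh h0 hC sd) _; apply: le_trans _ DB.
  by rewrite -[leRHS]mul1r ler_wpM2r// energy_ge0.
have NhT : a + N%:R * h <= T.
  by rewrite (le_trans _ NT)// lerD2l ler_wpM2r ?(ltW h0)// ler_nat.
have [phi [sphi Ephi ipphi]] := IH _ _ _ _ chiD chi2D eqn2 D2B NhT.
exists phi; split=> //.
  rewrite (le_trans Ephi)// exprSr -mulrA ler_wpM2l ?exprn_ge0 ?subr_ge0//.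
  apply: (le_trans _ (nuh h0 hC spsi)).
  apply: (resolvent_contraction q_gt0 hG (ltW h0) chiD _ eqn).
  by apply/sqintvD/sqintvZ/sqintvM.
have NS : N.+1%:R * h = N%:R * h + h by rewrite -natr1 mulrDl mul1r.
have aN : a <= a + N%:R * h by rewrite lerDl mulr_ge0// ltW.
rewrite NS addrA in NT *.
have := @euler_step psi dpsi chi dchi h _ eta omega B psiD chiD eqn h0 aN NT eta0 _ DB.
rewrite -natr1 [in X in _ -> X]mulrDl mul1r => step.
have : 2 * (ip psi (y (a + N%:R * h + h)) - ip chi (y (a + N%:R * h))) <=
    h * (eta * B + omega / eta + h * (C * B + M)).
  apply: step => s /andP[ts st]; apply: om.
  - by rewrite (le_trans aN ts) (le_trans st NT).
  - by rewrite NT (le_trans aN)// lerDl ltW.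
  - by rewrite ler_norml; apply/andP; split; lra.
by move: ipphi; lra.
Qed.

End euler.

Section decay.
Context {R : realType} {n : nat} {I : finType}.
Notation U := (`]0, 1[%classic : set R).
Context (Sys : switched_system R n I) (i : I) (q : 'rV[R]_n) (nu : R).
Hypothesis q_gt0 : positive_row q.
Hypothesis nu_gt0 : 0 < nu.
Hypothesis hF : lemx ((sysF Sys i)^T *m diag_mx q + diag_mx q *m sysF Sys i)
  (- (2 * nu) *: diag_mx q).
Hypothesis hG : lemx ((sysG Sys i)^T *m diag_mx q *m Lamp Sys i *m sysG Sys i)
  (diag_mx q *m Lamp Sys i).
Context (a T : R) (y : R -> R -> 'cV[R]_n).
Hypothesis aT : a < T.
Hypothesis sy : forall t, a <= t <= T -> sqintv (y t).
Hypothesis cy : forall t, a <= t <= T -> forall e, 0 < e ->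
  \forall s \near t, a <= s <= T -> energy q (fun x => y s x - y t x) < e.
Hypothesis wy : forall T', a < T' <= T -> weak_mode_sol Sys i a T' y.
Local Notation F := (sysF Sys i).
Local Notation Lam := (Lam Sys i).
Local Notation qi := (invrow q).
Local Notation Es := (energy qi).

Let qi0 : positive_row qi. Proof. exact: invrow_positive. Qed.

Lemma duality_bound psi dpsi : dual_dom Sys i psi dpsi ->
  2 * ip psi (y T) <= Es psi + expR (- nu * (T - a)) * energy q (y a).
Proof.
move=> psiD; have [spsi sdpsi] := dual_dom_sqintv psiD.
have [[cpsi _ _] _] := psiD.
apply/ler_addgt0Pr => eps eps0.
have [C C0 [FC nuh]] := explicit_step q_gt0 hF.
have [M M0 yM] := bounded_energy q_gt0 sy cy.
pose B := Es (fun x => Lam *m dpsi x + F^T *m psi x).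
have B0 : 0 <= B by exact: energy_ge0.
have tau0 : 0 < T - a by rewrite subr_gt0.
pose e1 := eps / (3 * (T - a)); have e10 : 0 < e1 by rewrite divr_gt0// mulr_gt0.
have B1 : 0 < B + 1 by rewrite ltr_wpDl.
pose eta := e1 / (B + 1); have eta0 : 0 < eta by rewrite divr_gt0.
have om0 : 0 < eta * e1 by rewrite mulr_gt0.
have [d d0 dP] := uniformly_continuous_energy q_gt0 sy cy om0.
have CBM : 0 < C * B + M + 1 by rewrite ltr_wpDl// addr_ge0// mulr_ge0// ltW.
pose hmax := Num.min (Num.min d (nu / C)) (Num.min nu^-1 (e1 / (C * B + M + 1))).
have hmax0 : 0 < hmax.
  have nuC : 0 < nu / C by rewrite divr_gt0.
  have e1C : 0 < e1 / (C * B + M + 1) by rewrite divr_gt0.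
  by rewrite !lt_min d0 nuC invr_gt0 nu_gt0 e1C.
pose N := (Num.truncn ((T - a) / hmax)).+1; pose h := (T - a) / N%:R.
have N0 : 0 < N%:R :> R by rewrite ltr0Sn.
have h0 : 0 < h by rewrite divr_gt0.
have Nh : N%:R * h = T - a by rewrite mulrC divfK// gt_eqF.
have : h < hmax by rewrite /h ltr_pdivrMr// mulrC -ltr_pdivrMr// truncnS_gt.
rewrite !lt_min => /andP[/andP[hd hC] /andP[hnu hCBM]].
have {}hC : h * C <= nu by rewrite -ler_pdivlMr// ltW.
have {}hnu : nu * h <= 1 by rewrite mulrC -ler_pdivlMr// mul1r ltW.
have {}hCBM : h * (C * B + M) <= e1.
  apply: (@le_trans _ _ (h * (C * B + M + 1))); first by rewrite ler_wpM2l ?lerDl// ltW.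
  by rewrite -ler_pdivlMr// ltW.
have cg : contv (fun x => psi x + h *: (F^T *m psi x)) by apply/contvD/contvZ/contvM.
have [chi [dchi [chiD eqn]]] := dual_resolvent q_gt0 hG h0 cg.
have DB : Es (fun x => h^-1 *: (chi x - psi x)) <= B.
  have dD := dual_dom_scale h^-1 (dual_dom_add chiD (dual_dom_scale (-1) psiD)).
  have dE : (fun x => h^-1 *: (chi x + -1 *: psi x)) = (fun x => h^-1 *: (chi x - psi x)).
    by apply/funext => x; rewrite scaleN1r.
  rewrite dE in dD.
  apply: (resolvent_contraction q_gt0 hG (ltW h0) dD).
    by apply: sqintvD; exact: sqintvM.
  move=> x; rewrite -!scalemxAr scaleN1r !mulmxBr.
  have /eqP := eqn x; rewrite !subr_eq.
  move: (F^T *m psi x) (Lam *m dchi x) (Lam *m dpsi x) => Y Z W /eqP ->.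
  by apply/colP => k; rewrite !mxE; field; rewrite gt_eqF.
have NT : a + N%:R * h = T by rewrite Nh addrC subrK.
have NleT : a + N%:R * h <= T by rewrite NT.
have om s t : a <= s <= T -> a <= t <= T -> `|s - t| <= h ->
    energy q (fun x => y s x - y t x) <= eta * e1.
  by move=> saT taT st; rewrite ltW// dP// (le_lt_trans st).
have [phi [sphi Ephi +]] := euler_iterate q_gt0 nu_gt0 hG sy cy wy (ltW C0) FC yM nuh
  psiD chiD eqn DB h0 hC hnu NleT eta0 om.
rewrite NT mulrA Nh => hphi; apply: le_trans hphi _.
have err : (T - a) * (eta * B + eta * e1 / eta + h * (C * B + M)) <= eps.
  have -> : eps = (T - a) * (e1 + e1 + e1).
    by rewrite /e1; field; rewrite gt_eqF.
  rewrite ler_wpM2l ?(ltW tau0)// lerD// lerD//.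
    by rewrite /eta mulrAC ler_pdivrMr// ler_wpM2l ?lerDl// ltW.
  by rewrite mulrAC mulfV ?mul1r// gt_eqF.
apply: lerD => //.
have aaT : a <= a <= T by rewrite lexx ltW.
have := ip_young q_gt0 (expR_gt0 (nu * (T - a))) sphi (sy aaT).
move=> /le_trans; apply; rewrite mulNr expRN lerD2r.
rewrite mulrC -ler_pdivlMr ?expR_gt0// (le_trans Ephi)// [leRHS]mulrC.
rewrite ler_wpM2r ?energy_ge0// -expRN -Nh.
have -> : - (nu * (N%:R * h)) = - (nu * h) * N%:R by ring.
rewrite expRM_natr lerXn2r ?nnegrE ?expR_ge0 ?subr_ge0//.
exact: expR_ge1Dx.
Qed.

Theorem mode_decay :
  energy q (y T) <= expR (- nu * (T - a)) * energy q (y a).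
Proof.
have TT : a <= T <= T by rewrite lexx ltW.
have sT := sy TT; pose w x := diag_mx q *m y T x.
have sw : sqintv w by exact: sqintvM.
apply/ler_addgt0Pr => eps eps0.
have [u [du [uC u0 u1 uw]]] := energy_dense qi0 sw eps0.
have uD : dual_dom Sys i u du.
  split=> //; rewrite /dual_bc u0 u1.
  have -> : stack Sys i 0 0 = 0 by apply/colP => k; rewrite !mxE; case: ifP.
  by rewrite !mulmx0.
have [su _] := dual_dom_sqintv uD.
have siu := sqintvM (diag_mx qi) su.
have := duality_bound uD.
suff -> : 2 * ip u (y T) = Es u + energy q (y T) - Es (fun x => u x - w x).
  by move: uw; lra.
have -> : Es (fun x => u x - w x) = Es u - 2 * ip u (y T) + energy q (y T).
  rewrite /energy.
  have -> : (fun x => diag_mx qi *m (u x - w x)) = (fun x => diag_mx qi *m u x - y T x).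
    apply/funext => x; rewrite mulmxBr /w; congr (_ - _).
    by have := invrowK (y T x) qi0; rewrite invrow_invrow.
  have wu : ip w (fun x => diag_mx qi *m u x) = ip u (y T).
    rewrite [RHS]ipC; apply: eq_Rintegral => x _.
    by rewrite /w dotvC dotv_diagC invrowK.
  rewrite ipBl//; last exact: sqintvB.
  by rewrite !ipBr// wu [ip w (y T)]ipC /w; ring.
ring.
Qed.

End decay.

(** * Concatenation of modes *)

Section L2_norm.
Context {R : realType} {n : nat}.
Notation mu := (@lebesgue_measure R).
Notation U := (`]0, 1[%classic : set R).
Implicit Types u : R -> 'cV[R]_n.

Lemma L2_sqintv u : L2 u -> sqintv u.
Proof. by move=> uL k; exact: Lfun2_sqint. Qed.

Lemma dotv_ge0 (v : 'cV[R]_n) : 0 <= dotv v v.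
Proof. by rewrite dotvE; apply: sumr_ge0 => k _; rewrite -expr2 sqr_ge0. Qed.

Lemma L2normE u : sqintv u -> L2norm u = (Num.sqrt (ip u u))%:E.
Proof.
move=> su; rewrite /L2norm unlock /=.
have -> : (\int[mu]_x `|((EFin \o (enorm \o u)) \_ U) x| `^ 2)%E = (ip u u)%:E.
  rewrite /ip /Rintegral fineK; last first.
    by apply: integrable_fin_num => //; exact: integrable_dotv.
  rewrite [RHS]integral_mkcond; apply: eq_integral => x _; rewrite !patchE.
  case: ifPn => _; last by rewrite abse0 poweR0r.
  rewrite /= /enorm ger0_norm ?sqrtr_ge0// powR_mulrn ?sqrtr_ge0//.
  by rewrite sqr_sqrtr// dotv_ge0.
by rewrite poweR_EFin powR12_sqrt// ip_ge0// => x; exact: dotv_ge0.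
Qed.

Lemma ip_ae_eq u v : sqintv u -> sqintv v ->
  u = v %[ae mu in U] -> ip u u = ip v v.
Proof.
move=> su sv uv; rewrite /ip /Rintegral; congr fine.
apply: ae_eq_integral => //.
- exact: measurable_int (integrable_dotv su su).
- exact: measurable_int (integrable_dotv sv sv).
- apply: filterS uv; first exact: (ae_filter_ringOfSetsType mu).
  by move=> x uvx Ux; rewrite uvx.
Qed.

Lemma C0L2_near (w : R -> R -> 'cV[R]_n) (t : R) : C0L2 w -> 0 <= t ->
  forall e, 0 < e -> \forall s \near t, 0 <= s ->
    ip (fun x => w s x - w t x) (fun x => w s x - w t x) < e.
Proof.
move=> [wL wC] t0 e e0; have se0 : 0 < Num.sqrt e by rewrite sqrtr_gt0.
have /fine_cvgP[_ /cvgr_lt /(_ _ se0)] := wC t t0.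
rewrite near_withinE; apply: filterS => s h s0.
have {}h : fine (L2norm (fun x => w s x - w t x)) < Num.sqrt e.
  by apply: h; rewrite /= in_itv/= s0.
rewrite L2normE/= in h; last by apply: sqintvB; apply/L2_sqintv/wL.
by move: h; rewrite ltr_sqrt.
Qed.

End L2_norm.

Section switching.
Context {R : realType}.

Lemma concatenate_decay (S : R -> Prop) (V : R -> R) (nu : R) :
  (forall a T, a = 0 \/ S a -> a < T -> (forall s, a < s < T -> ~ S s) ->
    V T <= expR (- nu * (T - a)) * V a) ->
  forall (l : seq R) a T, a = 0 \/ S a -> a <= T ->
    (forall s, a < s < T -> S s -> s \in l) ->
    V T <= expR (- nu * (T - a)) * V a.
Proof.
move=> dec; elim=> [|x l IH] a T Sa aT inl.
  have [->|aT'] := eqVneq a T; first by rewrite subrr mulr0 expR0 mul1r.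
  by apply: dec => //; [rewrite lt_neqAle aT'|move=> s sT /(inl _ sT)].
have [[/andP[ax xT] Sx]|nx] := pselect (a < x < T /\ S x).
  have VT : V T <= expR (- nu * (T - x)) * V x.
    apply: IH => //; [by right|exact: ltW|move=> s /andP[xs sT] Ss].
    have := inl s; rewrite (lt_trans ax xs) sT => /(_ isT Ss).
    by rewrite inE gt_eqF.
  have Vx : V x <= expR (- nu * (x - a)) * V a.
    apply: IH => //; [exact: ltW|move=> s /andP[as_ sx] Ss].
    have := inl s; rewrite as_ (lt_trans sx xT) => /(_ isT Ss).
    by rewrite inE lt_eqF.
  apply: le_trans VT _.
  have -> : - nu * (T - a) = - nu * (T - x) + - nu * (x - a) by ring.
  by rewrite expRD -mulrA ler_wpM2l ?expR_ge0.
apply: IH => // s asT Ss; have := inl s asT Ss; rewrite inE => /predU1P[sx|//].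
by case: nx; rewrite -sx.
Qed.

End switching.

Section stability.
Context {R : realType} {n : nat} {I : finType}.
Context (Sys : switched_system R n I) (Q : I -> 'M[R]_n).

Definition diag_row i : 'rV[R]_n := \row_k Q i k k.

Lemma diag_rowE i : is_diag_mx (Q i) -> Q i = diag_mx (diag_row i).
Proof.
move=> /is_diag_mxP Qd; apply/matrixP => k j; rewrite !mxE.
by case: eqVneq => [->|kj]; rewrite ?mulr1n// mulr0n Qd.
Qed.

Lemma diag_row_gt0 i : is_diag_mx (Q i) -> posdefmx (Q i) -> positive_row (diag_row i).
Proof.
move=> Qd [_ Qpos] k; have := Qpos (delta_mx k 0).
have -> : delta_mx k 0 != 0 :> 'cV[R]_n.
  by apply/eqP => /colP/(_ k)/eqP; rewrite !mxE !eqxx oner_eq0.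
move=> /(_ isT); rewrite -mulmxA -/(dotv _ _) {1}diag_rowE// dotv_diagsq.
rewrite (bigD1 k)//= big1 => [|j /negPf jk]; last by rewrite !mxE jk expr0n mulr0.
by rewrite addr0 [X in _ * X ^+ 2]mxE !eqxx expr1n mulr1.
Qed.

Definition lyapunov_mx i := (sysS Sys i)^T *m Q i *m sysS Sys i.

Lemma lyapunov_energy i u : is_diag_mx (Q i) ->
  energy (diag_row i) (fun x => sysS Sys i *m u x) =
  ip u (fun x => lyapunov_mx i *m u x).
Proof.
move=> Qd; rewrite /energy ipM; congr ip; apply/funext => x.
by rewrite -diag_rowE// !mulmxA.
Qed.

End stability.

Section constants.
Context {R : realType} {n : nat} {I : finType}.
Context (Sys : switched_system R n I) (Q : I -> 'M[R]_n) (i : I).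
Hypothesis Q_diag : is_diag_mx (Q i).
Hypothesis Q_posdef : posdefmx (Q i).
Implicit Types u : R -> 'cV[R]_n.
Local Notation P := (lyapunov_mx Sys Q i).
Local Notation S := (sysS Sys i).

Let one_gt0 : positive_row (const_mx 1 : 'rV[R]_n). Proof. by move=> k; rewrite mxE. Qed.

Lemma dotv_const1 (v : 'cV[R]_n) : dotv v (diag_mx (const_mx 1) *m v) = dotv v v.
Proof. by rewrite diag_const_mx mul1mx. Qed.

Lemma lyapunov_upper : exists2 C, 0 < C & forall u, sqintv u ->
  ip u (fun x => P *m u x) <= C * ip u u.
Proof.
have [C C0 CP] := form_bounded P one_gt0; exists C => // u su.
rewrite -ipZl//; apply: ip_le => //; [exact: sqintvM|exact: sqintvZ|move=> x].
by rewrite dotvZl -dotv_const1.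
Qed.

Lemma lyapunov_lower : exists2 C, 0 < C & forall u, sqintv u ->
  ip u u <= C * ip u (fun x => P *m u x).
Proof.
have q0 := diag_row_gt0 Q_diag Q_posdef.
have [C C0 CP] := form_bounded ((invmx S)^T *m invmx S) q0; exists C => // u su.
have sPu := sqintvM P su.
rewrite -ipZl//; apply: ip_le => //; first exact: sqintvZ.
move=> x; rewrite dotvZl; have := CP (S *m u x).
have -> : dotv (S *m u x) ((invmx S)^T *m invmx S *m (S *m u x)) = dotv (u x) (u x).
  by rewrite -mulmxA -dotvM mulKmx// sysS_unit.
by rewrite -diag_rowE// dotvM /lyapunov_mx !mulmxA.
Qed.

Lemma lyapunov_near (w : R -> R -> 'cV[R]_n) (t : R) : C0L2 w -> 0 <= t ->
  forall e, 0 < e -> \forall s \near t, 0 <= s ->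
    energy (diag_row Q i) (fun x => S *m w s x - S *m w t x) < e.
Proof.
move=> wC t0 e e0; have [C C0 CP] := lyapunov_upper.
have eC : 0 < e / C by rewrite divr_gt0.
have := C0L2_near wC t0 eC; apply: filterS => s h s0.
have -> : (fun x => S *m w s x - S *m w t x) = (fun x => S *m (w s x - w t x)).
  by apply/funext => x; rewrite mulmxBr.
rewrite lyapunov_energy//; apply: le_lt_trans (CP _ _) _.
  by case: wC => wL _; apply: sqintvB; apply/L2_sqintv/wL.
by rewrite mulrC -ltr_pdivlMr// h.
Qed.

End constants.

Theorem theorem3 (R : realType) (n : nat) (I : finType)
    (Sys : switched_system R n I) (nu : R) (Q : I -> 'M[R]_n)
    (nu_gt0 : 0 < nu)
    (Q_diag : forall i, is_diag_mx (Q i))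
    (Q_posdef : forall i, posdefmx (Q i))
    (hF : forall i,
      lemx ((sysF Sys i)^T *m Q i + Q i *m sysF Sys i) (- (2 * nu) *: Q i))
    (hG : forall i,
      lemx ((sysG Sys i)^T *m Q i *m Lamp Sys i *m sysG Sys i)
           (Q i *m Lamp Sys i))
    (hS : forall i j,
      (sysS Sys i)^T *m Q i *m sysS Sys i =
      (sysS Sys j)^T *m Q j *m sysS Sys j) :
  GUES Sys [set sigma | switching_signal sigma]%classic.
Proof.
have [[i0 _]|noI] := pselect (exists i : I, True); last first.
  by exists nu, 1; split=> // w0 sigma; case: noI; exists (sigma 0).
have [C1 C1_gt0 lower] := lyapunov_lower Sys (Q_diag i0) (Q_posdef i0).
have [C2 C2_gt0 upper] := lyapunov_upper Sys Q i0.
exists (nu / 2), (Num.sqrt (C1 * C2)); split; first by rewrite divr_gt0.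
  by rewrite sqrtr_gt0 mulr_gt0.
move=> w0 sigma w0L [_ _ sigma_fin] w [wC w00 wsol] t t_ge0.
have sw (s : R) : 0 <= s -> sqintv (w s) by move=> s0; case: wC => wL _; exact/L2_sqintv/wL.
pose V s := ip (w s) (fun x => lyapunov_mx Sys Q i0 *m w s x).
have VE i s : V s = energy (diag_row Q i) (fun x => sysS Sys i *m w s x).
  by rewrite lyapunov_energy// /V /lyapunov_mx (hS i0 i).
have decay (a T : R) : a = 0 \/ switching_time sigma a -> a < T ->
    (forall s : R, a < s < T -> ~ switching_time sigma s) ->
    V T <= expR (- nu * (T - a)) * V a.
  move=> a_start aT nosw; rewrite !(VE (sigma a)).
  have a0 : 0 <= a by case: a_start => [->//|[/ltW]].
  apply: (@mode_decay _ _ _ Sys (sigma a) (diag_row Q (sigma a)) nu _ _ _ _ a T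
    (fun s x => sysS Sys (sigma a) *m w s x)) => //.
  - exact: diag_row_gt0.
  - by have := hF (sigma a); rewrite {1 2 3}(diag_rowE (Q_diag _)).
  - by have := hG (sigma a); rewrite {1 2}(diag_rowE (Q_diag _)).
  - by move=> s /andP[as_ _]; apply: sqintvM; apply: sw; exact: le_trans as_.
  - move=> s /andP[as_ _] e e0.
    have := lyapunov_near Sys (Q_diag (sigma a)) wC (le_trans a0 as_) e0.
    by apply: filterS => r h /andP[ar _]; apply: h; exact: le_trans ar.
  - move=> T' /andP[aT' T'T]; apply: wsol => // s /andP[as_ sT'].
    by apply: nosw; rewrite as_ (lt_le_trans sT').
have [l lE] := (finite_seqP _).1 (sigma_fin t).
have Vt : V t <= expR (- nu * (t - 0)) * V 0.
  apply: (concatenate_decay decay (l := l)) => //; first by left.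
  move=> s /andP[_ st] ss.
  by have : [set` l]%classic s by rewrite -lE /=; split=> //; exact: ltW.
rewrite subr0 in Vt.
have sw0 := L2_sqintv w0L.
rewrite !L2normE//; last exact: sw.
rewrite -EFinM lee_fin -(ip_ae_eq (sw 0 (lexx 0)) sw0 w00).
have half : expR (- (nu / 2) * t) = Num.sqrt (expR (- nu * t)).
  have -> : expR (- nu * t) = expR (- (nu / 2) * t) ^+ 2.
    by rewrite expr2 -expRD; congr expR; field.
  by rewrite sqrtr_sqr ger0_norm// expR_ge0.
rewrite half -sqrtrM ?mulr_ge0 ?(ltW C1_gt0) ?(ltW C2_gt0)//.
rewrite -sqrtrM ?mulr_ge0 ?expR_ge0 ?(ltW C1_gt0) ?(ltW C2_gt0)//.
apply: ler_wsqrtr.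
apply: le_trans (lower _ (sw t t_ge0)) _; rewrite -!mulrA ler_wpM2l ?(ltW C1_gt0)//.
apply: le_trans Vt _; rewrite mulrCA ler_wpM2l ?expR_ge0//.
exact/upper/sw.
Qed.
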